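(* Let $\lambda$ be a positive measure such that $$\forall K>0,\quad r(K):=\int_{[K,+\infty)}\int_{[K,+\infty)}\frac1{\rho_1+\rho_2}\,\lambda(d\rho_1)\lambda(d\rho_2)<\infty .$$ Then, for any $T>0$, there exists a positive constant $C$ that depends on $T$, $\lambda$, ${\bf M}_1$, ${\bf M}_2$, $L$, $|b(0)|$ and $\|\sigma(0)\|$ such that, for all $K>0$, $$\forall t\in[0,T],\quad \mathbb{E}\big[|X_t-X^K_t|^2\big]\le C\times r(K),$$ where $X$ and $X^K$ are the solutions of $$X_t=x_0+\int_0^tG_1(t-s)b(X_s)ds+\int_0^tG_2(t-s)\sigma(X_s)dW_s,$$ $$X^K_t=x_0+\int_0^tG^K_1(t-s)b(X^K_s)ds+\int_0^tG^K_2(t-s)\sigma(X^K_s)dW_s .$$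
   Context: Fix $d\ge1$, $x_0\in\mathbb{R}^d$ and a standard Brownian motion $W$ in $\mathbb{R}^d$. $\mathcal{M}_d(\mathbb{R})$ is the space of real $d\times d$ matrices, $|\cdot|$ is the Euclidean norm on $\mathbb{R}^d$ and $\|\cdot\|$ the Frobenius norm on $\mathcal{M}_d(\mathbb{R})$; $\mathbb{R}_+=[0,\infty)$. The coefficients $b:\mathbb{R}^d\to\mathbb{R}^d$ and $\sigma:\mathbb{R}^d\to\mathcal{M}_d(\mathbb{R})$ satisfy, for some $L>0$, $|b(x)-b(y)|+\|\sigma(x)-\sigma(y)\|\le L|x-y|$ for all $x,y\in\mathbb{R}^d$. The measure $\lambda$ on $\mathbb{R}_+$ is such that $\bar G(t):=\int_{\mathbb{R}_+}e^{-\rho t}\lambda(d\rho)<\infty$ for all $t>0$ and $\int_0^{S}\bar G(t)^2dt<\infty$ for all $S>0$. $M_1,M_2:\mathbb{R}_+\to\mathcal{M}_d(\mathbb{R})$ are bounded measurable functions, ${\bf M}_j=\sup_{\rho\ge0}\|M_j(\rho)\|$, $G_j(t)=\int_{\mathbb{R}_+}e^{-\rho t}M_j(\rho)\lambda(d\rho)$ for $t>0$, and the truncated kernels are $G^K_j(t)=\int_{[0,K)}e^{-\rho t}M_j(\rho)\lambda(d\rho)$ for $K>0$, $t\ge0$, $j\in\{1,2\}$. Under these assumptions the two stochastic Volterra equations have unique strong solutions (a known result of X. Zhang). *)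

(* Defs.v *)
From mathcomp Require Import all_boot all_order all_algebra.
From mathcomp Require Import all_classical all_reals all_analysis.

Set Implicit Arguments.
Unset Strict Implicit.
Unset Printing Implicit Defensive.

Import Order.TTheory GRing.Theory Num.Theory.
Import numFieldNormedType.Exports.

Local Open Scope classical_set_scope.
Local Open Scope ring_scope.

(* The library norm on matrices is the sup norm. [frob] is the Frobenius norm
   on 'M[R]_d, and the Euclidean norm on column vectors 'cV[R]_d. *)
Definition frob (R : realType) (m n : nat) (A : 'M[R]_(m, n)) : R :=
  Num.sqrt (\sum_i \sum_j A i j ^+ 2).

(* The library has no sigma-algebra on 'M[R]_(m, n): measurability of
   matrix-valued maps is measurability of every entry. *)
Definition mx_measurable (R : realType) (d : measure_display)
    (T : measurableType d) (m n : nat) (D : set T) (f : T -> 'M[R]_(m, n)) :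
    Prop :=
  forall i j, measurable_fun D (fun x => f x i j : measurableTypeR R).

(* Measurability with respect to a class of sets [G], used with [G] a
   sub-sigma-algebra of the ambient one. *)
Definition mx_measurable_wrt (R : realType) (T : Type) (m n : nat)
    (G : set (set T)) (f : T -> 'M[R]_(m, n)) : Prop :=
  forall i j (B : set (measurableTypeR R)), measurable B ->
    G ((fun x => f x i j) @^-1` B).

Section Kernels.
Context {R : realType}.
Implicit Type lam : {measure set (measurableTypeR R) -> \bar R}.

(* [lam] is a measure on the whole line, but only its restriction to the
   half-line [0, +oo[ is ever used. *)
Definition Gbar lam (t : R) : \bar R :=
  (\int[lam]_(rho in `[0%R, +oo[) (expR (- rho * t))%:E)%E.

Definition tail_energy lam (K : R) : \bar R :=
  (\int[lam]_(rho1 in `[K, +oo[)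
     \int[lam]_(rho2 in `[K, +oo[) ((rho1 + rho2)^-1)%:E)%E.

Definition laplace_on lam (d : nat) (D : set R) (M : R -> 'M[R]_d) (t : R) :
    'M[R]_d :=
  \matrix_(i, j) \int[lam]_(rho in D) (expR (- rho * t) * M rho i j).

Definition full_kernel lam (d : nat) (M : R -> 'M[R]_d) : R -> 'M[R]_d :=
  laplace_on lam `[0, +oo[ M.

Definition trunc_kernel lam (d : nat) (K : R) (M : R -> 'M[R]_d) :
    R -> 'M[R]_d :=
  laplace_on lam `[0, K[ M.

Definition bounded_measurable (d : nat) (M : R -> 'M[R]_d) : Prop :=
  mx_measurable (`[0, +oo[ : set (measurableTypeR R)) M /\
  exists c : R, forall rho : R, 0 <= rho -> frob (M rho) <= c.

Definition sup_frob (d : nat) (M : R -> 'M[R]_d) : R :=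
  sup [set frob (M rho) | rho in `[0, +oo[].

Definition lipschitz_coeffs (d : nat) (L : R) (b : 'cV[R]_d -> 'cV[R]_d)
    (sigma : 'cV[R]_d -> 'M[R]_d) : Prop :=
  forall x y,
    frob (b x - b y) + frob (sigma x - sigma y) <= L * frob (x - y).

End Kernels.

(* In this section processes are indexed by R, but only times t >= 0 matter. *)
Section StochasticCalculus.
Context {R : realType} {dOm : measure_display} {Om : measurableType dOm}.
Variable P : probability Om R.

Definition filtration (F : R -> set (set Om)) : Prop :=
  [/\ forall t : R, 0 <= t -> sigma_algebra setT (F t),
      forall t : R, 0 <= t -> F t `<=` measurable &
      forall s t : R, 0 <= s -> s <= t -> F s `<=` F t].

Definition adapted (F : R -> set (set Om)) (m n : nat)
    (H : R -> Om -> 'M[R]_(m, n)) : Prop :=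
  forall t : R, 0 <= t -> mx_measurable_wrt (F t) (H t).

Definition jointly_measurable (m n : nat) (H : R -> Om -> 'M[R]_(m, n)) :
    Prop :=
  mx_measurable ((`[0, +oo[ `*` setT) : set (measurableTypeR R * Om)%type)
    (fun p => H p.1 p.2).

(* The last condition is the mutual independence of the past [F s] and of the
   [d] coordinates of the increment; the coordinates have law N(0, t - s). The
   second parameter of [normal_prob] is the standard deviation. *)
Definition brownian_motion (d : nat) (F : R -> set (set Om))
    (W : R -> Om -> 'cV[R]_d) : Prop :=
  [/\ adapted F W,
      {ae P, forall w, W 0 w = 0},
      {ae P, forall w, forall i,
         {within `[0, +oo[, continuous (fun t : R => W t w i ord0)}},
      forall s t : R, 0 <= s -> s < t ->
        forall i (B : set (measurableTypeR R)), measurable B ->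
          P [set w | B (W t w i ord0 - W s w i ord0)] =
          normal_prob 0 (Num.sqrt (t - s)) B &
      forall s t : R, 0 <= s -> s < t ->
        forall (A : set Om) (B : 'I_d -> set (measurableTypeR R)),
          F s A -> (forall i, measurable (B i)) ->
          P (A `&` [set w | forall i, B i (W t w i ord0 - W s w i ord0)]) =
          (P A *
           \prod_(i < d) P [set w | B i (W t w i ord0 - W s w i ord0)%R])%E].

(* A simple process on [0, t] is
     sum_(k < n) xi_k 1_(]tau_k, tau_(k+1)])
   with 0 = tau_0 <= ... <= tau_n = t and xi_k bounded, F_(tau_k)-measurable. *)
Definition is_simple (d : nat) (F : R -> set (set Om)) (t : R)
    (n : nat) (tau : nat -> R) (xi : nat -> Om -> 'M[R]_d) : Prop :=
  [/\ tau 0%N = 0, tau n = t,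
      forall k, (k < n)%N -> tau k <= tau k.+1,
      forall k, (k < n)%N -> mx_measurable_wrt (F (tau k)) (xi k) &
      exists c : R, forall k w, (k < n)%N -> frob (xi k w) <= c].

Definition simple_process (d : nat) (n : nat) (tau : nat -> R)
    (xi : nat -> Om -> 'M[R]_d) (s : R) (w : Om) : 'M[R]_d :=
  \sum_(k < n) (\1_(`]tau k, tau k.+1] : set R) s : R) *: xi k w.

Definition simple_integral (d : nat) (W : R -> Om -> 'cV[R]_d) (n : nat)
    (tau : nat -> R) (xi : nat -> Om -> 'M[R]_d) (w : Om) : 'cV[R]_d :=
  \sum_(k < n) xi k w *m (W (tau k.+1) w - W (tau k) w).

(* [I] is (a version of) the Ito integral of [H] over [0, t] against [W]: the
   limit in L^2(P) of the integrals of simple processes converging to [H] in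
   L^2(P x dt). By the Ito isometry it does not depend on the approximating
   sequence, up to almost sure equality. *)
Definition is_ito_integral (d : nat) (F : R -> set (set Om))
    (W : R -> Om -> 'cV[R]_d) (t : R) (H : R -> Om -> 'M[R]_d)
    (I : Om -> 'cV[R]_d) : Prop :=
  [/\ mx_measurable ((`[0, t] `*` setT) : set (measurableTypeR R * Om)%type)
        (fun p => H p.1 p.2),
      forall s : R, 0 <= s -> s <= t -> mx_measurable_wrt (F s) (H s),
      mx_measurable setT I &
      exists (n : nat -> nat) (tau : nat -> nat -> R)
             (xi : nat -> nat -> Om -> 'M[R]_d),
        [/\ forall m, is_simple F t (n m) (tau m) (xi m),
            (fun m => \int[P]_w \int[lebesgue_measure]_(s in `[0%R, t])
               (frob (H s w - simple_process (n m) (tau m) (xi m) s w)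
                  ^+ 2)%:E)%E @ \oo --> 0%E &
            (fun m => 'E_P[fun w =>
               (frob (I w - simple_integral W (n m) (tau m) (xi m) w)
                  ^+ 2)%R])%E @ \oo --> 0%E]].

(* Solutions, on a given basis (Om, P, F) carrying a given F-Brownian motion W,
   of
     X_t = x0 + int_0^t G1(t-s) b(X_s) ds + int_0^t G2(t-s) sigma(X_s) dW_s,
   in the class of measurable adapted processes which are square-integrable
   over [0, S] x Om for every S. Paths need not be continuous, so the
   equation is required at every time t, almost surely. *)
Definition volterra_solution (d : nat) (F : R -> set (set Om))
    (W : R -> Om -> 'cV[R]_d) (x0 : 'cV[R]_d)
    (b : 'cV[R]_d -> 'cV[R]_d) (sigma : 'cV[R]_d -> 'M[R]_d)
    (G1 G2 : R -> 'M[R]_d) (X : R -> Om -> 'cV[R]_d) : Prop :=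
  [/\ jointly_measurable X,
      adapted F X,
      forall S : R, 0 < S ->
        (\int[lebesgue_measure]_(s in `[0%R, S])
           'E_P[fun w => (frob (X s w) ^+ 2)%R] < +oo)%E &
      forall t : R, 0 <= t -> exists I : Om -> 'cV[R]_d,
        is_ito_integral F W t
          (fun s w => G2 (t - s) *m sigma (X s w)) I /\
        {ae P, forall w,
          (forall i, lebesgue_measure.-integrable `[0, t]
             (fun s : R => ((G1 (t - s) *m b (X s w)) i ord0)%:E)) /\
          X t w = x0
            + \col_i \int[lebesgue_measure]_(s in `[0, t])
                       ((G1 (t - s) *m b (X s w)) i ord0)
            + I w}].

End StochasticCalculus.

(* Main.v *)
From HB Require Import structures.
Require Import Defs.
From mathcomp Require Import all_boot all_order all_algebra.
From mathcomp Require Import all_classical all_reals all_analysis.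
From mathcomp Require Import measurable_realfun.
From mathcomp Require Import ring lra.

Set Implicit Arguments.
Unset Strict Implicit.
Unset Printing Implicit Defensive.

Import Order.TTheory GRing.Theory Num.Theory.
Import numFieldNormedType.Exports.

Local Open Scope classical_set_scope.
Local Open Scope ring_scope.

(* Write [X - XK] as the sum of a drift and a stochastic integral with integrands
     (G - GK)(t - s) f(X_s) + GK(t - s) (f(X_s) - f(XK_s)),   f = b, sigma.
   The kernels satisfy |GK_j| <= M_j Gbar and |G_j - GK_j| <= M_j Gbar_K with
   Gbar_K(t) := int_[K, oo[ e^(-rho t) lambda(d rho), and by Tonelli
   int_0^oo Gbar_K(t)^2 dt = r(K). Cauchy-Schwarz for the drift, the Ito isometry
   for the stochastic integral and the Lipschitz condition give
     E|X_t - XK_t|^2 <= B (1 + sup_[0,T] E|X|^2) r(K)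
                        + B int_0^t Gbar(t - s)^2 E|X_s - XK_s|^2 ds,
   and a Gronwall lemma for the integrable kernel Gbar^2, whose constant depends
   only on Gbar, B and T, concludes. The same lemma bounds E|X_t|^2. *)

(** The tail kernel is paired with [X] rather than with [XK] because the second moment of [X] does
    not involve [K]; the kernel left in front of the unknown is then the truncated one, which [Gbar]
    dominates whatever [K] is.

    The constant precedes the probability space, the coefficients and [K], so every intermediate
    constant has to be a function of the fixed data alone, and both uses of the Gronwall lemma must
    share one constant.

    The second moments are only known to be integrable in time, not bounded, and the kernel [Gbar^2]
    may be singular at 0. The Gronwall lemma therefore damps by [e^(-beta t)], which makes the mass
    of the kernel small, and compares integrals before it returns to pointwise values. Kernel bounds
    are stated in the extended reals because [Gbar] may be infinite at 0.

    Ito integrals are given only as L^2 limits, so the isometry is rebuilt from the independence of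
    increments; a bound up to a constant factor suffices for Gronwall. *)

Section Integral.
Context {d : measure_display} {T : measurableType d} {R : realType}.
Local Open Scope ereal_scope.
Implicit Types (mu : {measure set T -> \bar R}) (f g : T -> \bar R).

(* No measurability: the integral of a nonnegative function is a supremum of
   integrals of simple functions. *)
Lemma ge0_le_integral_nomeas mu (D : set T) f g :
  (forall x, D x -> 0 <= f x) -> (forall x, D x -> f x <= g x) ->
  \int[mu]_(x in D) f x <= \int[mu]_(x in D) g x.
Proof.
move=> f0 fg.
have g0 x : D x -> 0 <= g x by move=> Dx; exact: le_trans (f0 _ Dx) (fg _ Dx).
rewrite integral_mkcond [leRHS]integral_mkcond.
have pf h : (forall x, D x -> 0 <= h x) -> forall x, [set: T] x -> 0 <= (h \_ D) x.
  by move=> h0 x _; rewrite patchE; case: ifPn => // /set_mem; exact: h0.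
rewrite ge0_integralTE ?ge0_integralTE; try by move=> x; apply: pf.
apply: le_ereal_sup => _ [h hf <-]; exists h => // x /=.
apply: le_trans (hf x) _; rewrite !patchE; case: ifPn => // /set_mem; exact: fg.
Qed.

Lemma integrable_ge0_ltey mu f : measurable_fun setT f ->
  (forall x, 0 <= f x) -> \int[mu]_x f x < +oo -> mu.-integrable setT f.
Proof.
by move=> mf f0 fi; apply/integrableP; split=> //; under eq_integral do rewrite gee0_abs//.
Qed.

End Integral.

(** * Independence and product laws *)

Section Independence.
Context {d : measure_display} {T : measurableType d} {R : realType}.
Variable P : probability T R.
Local Open Scope ereal_scope.

(** Independence says that the joint law and the product of the marginal laws agree on rectangles;
    uniqueness of the product measure extends this to all measurable sets, and Tonelli gives the
    iterated integral. *)
Let pair_law (X Y : {mfun T >-> measurableTypeR R}) :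
  (forall A B : set (measurableTypeR R), measurable A -> measurable B ->
    P (X @^-1` A `&` Y @^-1` B) = P (X @^-1` A) * P (Y @^-1` B)) ->
  forall f : measurableTypeR R * measurableTypeR R -> \bar R,
  measurable_fun setT f -> (forall z, 0 <= f z) ->
  \int[P]_w f (X w, Y w) =
  \int[distribution P X]_x \int[distribution P Y]_y f (x, y).
Proof.
move=> XY f mf f0.
pose Z : {mfun T >-> (measurableTypeR R * measurableTypeR R)%type} :=
  HB.pack (fun w => (X w, Y w))
   (isMeasurableFun.Build _ _ _ _ (fun w => (X w, Y w))
      (measurable_fun_pair (measurable_funPT X) (measurable_funPT Y))).
rewrite -fubini_tonelli1//.
rewrite (eq_measure_integral (distribution P Z)); last first.
  by move=> A mA _; apply: product_measure_unique => // B C mB mC /=; rewrite -XY.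
by rewrite ge0_integral_distribution.
Qed.

Lemma indep_ge0_integralM (X Y : T -> measurableTypeR R) (f g : measurableTypeR R -> \bar R) :
  measurable_fun setT X -> measurable_fun setT Y ->
  (forall A B : set (measurableTypeR R), measurable A -> measurable B ->
    P (X @^-1` A `&` Y @^-1` B) = P (X @^-1` A) * P (Y @^-1` B)) ->
  measurable_fun setT f -> measurable_fun setT g ->
  (forall x, 0 <= f x) -> (forall x, 0 <= g x) ->
  \int[P]_w (f (X w) * g (Y w)) = \int[P]_w f (X w) * \int[P]_w g (Y w).
Proof.
move=> mX mY XY mf mg f0 g0.
pose X' : {mfun T >-> measurableTypeR R} := HB.pack X (isMeasurableFun.Build _ _ _ _ X mX).
pose Y' : {mfun T >-> measurableTypeR R} := HB.pack Y (isMeasurableFun.Build _ _ _ _ Y mY).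
have mF : measurable_fun setT (fun z : measurableTypeR R * measurableTypeR R => f z.1 * g z.2).
  by apply: emeasurable_funM; apply: measurableT_comp.
rewrite (@pair_law X' Y' XY (fun z => f z.1 * g z.2))//=; last first.
  by move=> z; apply: mule_ge0.
under eq_integral do rewrite ge0_integralZl//.
rewrite ge0_integralZr//; last by apply: integral_ge0.
by rewrite !ge0_integral_distribution.
Qed.

(** The nonnegative case applied to the absolute values yields integrability of the product, which
    is not assumed; Fubini for the product of the two laws then gives its value. *)
Lemma indep_expectationM (X Y : T -> measurableTypeR R) :
  (forall A B : set (measurableTypeR R), measurable A -> measurable B ->
    P (X @^-1` A `&` Y @^-1` B) = P (X @^-1` A) * P (Y @^-1` B)) ->
  P.-integrable setT (EFin \o X) -> P.-integrable setT (EFin \o Y) ->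
  P.-integrable setT (fun w => (X w * Y w)%:E) /\
  \int[P]_w (X w * Y w)%:E = \int[P]_w (X w)%:E * \int[P]_w (Y w)%:E.
Proof.
move=> XY iX iY.
have mX : measurable_fun setT X by apply/measurable_EFinP; exact: measurable_int iX.
have mY : measurable_fun setT Y by apply/measurable_EFinP; exact: measurable_int iY.
have mabs : measurable_fun setT (fun x : measurableTypeR R => `|x%:E|).
  by apply: measurableT_comp => //; apply/measurable_EFinP.
have fin : \int[P]_w `|(X w * Y w)%:E| < +oo.
  under eq_integral do rewrite EFinM abseM.
  rewrite (indep_ge0_integralM mX mY XY mabs mabs)//.
  case/integrableP: iX => _ iX; case/integrableP: iY => _ iY.
  by rewrite lte_mul_pinfty ?integral_ge0// ge0_fin_numE// integral_ge0.
have mXY : measurable_fun setT (fun w => (X w * Y w)%:E).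
  by apply/measurable_EFinP; exact: measurable_funM.
split; first exact/integrableP.
pose X' : {mfun T >-> measurableTypeR R} := HB.pack X (isMeasurableFun.Build _ _ _ _ X mX).
pose Y' : {mfun T >-> measurableTypeR R} := HB.pack Y (isMeasurableFun.Build _ _ _ _ Y mY).
pose Z : {mfun T >-> (measurableTypeR R * measurableTypeR R)%type} :=
  HB.pack (fun w => (X w, Y w))
   (isMeasurableFun.Build _ _ _ _ (fun w => (X w, Y w))
      (measurable_fun_pair mX mY)).
pose F := fun z : measurableTypeR R * measurableTypeR R => (z.1 * z.2)%:E.
have mF : measurable_fun setT F.
  by apply/measurable_EFinP; apply: measurable_funM.
have iF : (distribution P X' \x distribution P Y').-integrable setT F.
  apply/integrable12ltyP => //.
  by rewrite -(@pair_law X' Y' XY (abse \o F))//=; apply: measurableT_comp.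
have iX' : (distribution P X').-integrable setT (EFin \o id).
  by apply: integrable_pushforward => //; apply/measurable_EFinP.
have iY' : (distribution P Y').-integrable setT (EFin \o id).
  by apply: integrable_pushforward => //; apply/measurable_EFinP.
transitivity (\int[distribution P Z]_z F z).
  by rewrite integral_distribution//; apply/integrableP.
rewrite (eq_measure_integral (distribution P X' \x distribution P Y')%E); last first.
  by move=> A mA _; apply/esym; apply: product_measure_unique => // B C mB mC /=; rewrite -XY.
rewrite -integral12_prod_meas1// /fubini_F /F /=.
under eq_integral do rewrite (integralZl measurableT iY').
rewrite muleC -[in RHS](integral_distribution (X := X') (f := EFin \o id))//; last first.
  by apply/measurable_EFinP.
rewrite -[in RHS](integral_distribution (X := Y') (f := EFin \o id))//; last first.
  by apply/measurable_EFinP.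
have := integrable_fin_num measurableT iY'; move: (integral _ _ _) => [r| |]// _.
by rewrite /= -(integralZl measurableT iX'); apply: eq_integral => x _; rewrite muleC.
Qed.

End Independence.

(** * Brownian increments *)

Section Gaussian.
Context {R : realType}.
Local Notation mu := (@lebesgue_measure R).

(** The Radon-Nikodym derivative of [normal_prob m s] has the same integral as [normal_pdf m s] over
    every measurable set, hence coincides with it almost everywhere. *)
Lemma ge0_integral_normal_prob (m s : R) (f : R -> \bar R) :
  measurable_fun setT f -> (forall x, 0 <= f x)%E ->
  (\int[normal_prob m s]_x f x = \int[mu]_x (f x * (normal_pdf m s x)%:E))%E.
Proof.
move=> mf f0.
have dom := normal_prob_dominates m s.
rewrite -(Radon_Nikodym_SigmaFinite.change_of_variables dom)//.
have mpdf : measurable_fun setT (fun x => (normal_pdf m s x)%:E).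
  by apply/measurable_EFinP; exact: measurable_normal_pdf.
apply: ae_eq_integral => //.
- apply: emeasurable_funM => //; apply: (measurable_int mu).
  exact: Radon_Nikodym_SigmaFinite.f_integrable.
- exact: emeasurable_funM.
- apply: ae_eqe_mul2l => /=.
  apply: integral_ae_eq => //=; first exact: Radon_Nikodym_SigmaFinite.f_integrable.
  by move=> E _ mE; rewrite -Radon_Nikodym_SigmaFinite.f_integral.
Qed.

Lemma normal_pdf_pos (s x : R) : 0 < s ->
  normal_pdf 0 s x = normal_peak s * expR (- (x ^+ 2 / (s ^+ 2 *+ 2))).
Proof.
move=> s0; transitivity (normal_peak s * normal_fun 0 s x).
  by rewrite normal_pdfE ?gt_eqF.
by rewrite /normal_fun subr0 mulNr.
Qed.

Lemma normal_pdfN (s x : R) : 0 < s -> normal_pdf 0 s (- x) = normal_pdf 0 s x.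
Proof. by move=> s0; rewrite !normal_pdf_pos// sqrrN. Qed.

Lemma normal_pdf_scale (s y : R) : 0 < s ->
  normal_pdf 0 s (s * y) * s = normal_pdf 0 1 y.
Proof.
move=> s0; rewrite !normal_pdf_pos// /normal_peak mulrAC; congr (_ * expR (- _)).
  rewrite expr1n mul1r -mulrnAr sqrtrM ?sqr_ge0// sqrtr_sqr gtr0_norm//.
  by rewrite invfM mulrAC mulVf ?gt_eqF// mul1r.
rewrite expr1n -[_ *+ 2]mulr_natr invfM mulrA exprMn [s ^+ 2 * _]mulrC mulfK//.
by rewrite sqrf_eq0 gt_eqF.
Qed.

(* The value of this second moment is 1, but only its finiteness and the scaling
   of [normal_prob_second_moment] matter. *)
Definition gauss_var : \bar R := (\int[mu]_x (x ^+ 2 * normal_pdf 0 1 x)%:E)%E.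

(** Half of the exponent absorbs the square: with [y = x^2 / 4], the bound [y <= e^y] gives
    [x^2 e^(-x^2/2) = 4 y e^(-2y) <= 4 e^(-y)], a multiple of the density with standard deviation
    [sqrt 2]. *)
Lemma gauss_var_fin : gauss_var \is a fin_num.
Proof.
rewrite ge0_fin_numE; last first.
  by apply: integral_ge0 => x _; rewrite lee_fin mulr_ge0 ?sqr_ge0 ?normal_pdf_ge0.
pose r : R := Num.sqrt 2.
have r0 : 0 < r by rewrite sqrtr_gt0.
pose C : R := 4 * normal_peak 1 / normal_peak r.
have p0 : 0 < normal_peak r by rewrite normal_peak_gt0// gt_eqF.
have C0 : 0 <= C by rewrite divr_ge0 ?mulr_ge0 ?normal_peak_ge0.
apply: (@le_lt_trans _ _ (\int[mu]_x (C%:E * (normal_pdf 0 r x)%:E))%E).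
  apply: ge0_le_integral_nomeas => x _.
    by rewrite lee_fin mulr_ge0 ?sqr_ge0 ?normal_pdf_ge0.
  rewrite -EFinM lee_fin !normal_pdf_pos// /C [leRHS]mulrA divfK ?gt_eqF//.
  rewrite [4 * _]mulrC -[leRHS]mulrA mulrCA ler_pM2l ?normal_peak_gt0 ?oner_eq0//.
  rewrite expr1n sqr_sqrtr//.
  set y := x ^+ 2 / (2 *+ 2).
  have -> : x ^+ 2 / (1 *+ 2) = y + y by rewrite /y; field.
  have -> : x ^+ 2 = 4 * y by rewrite /y; field.
  rewrite -mulrA ler_pM2l// opprD expRD mulrA ler_piMl ?expR_ge0//.
  rewrite expRN ler_pdivrMr ?expR_gt0// mul1r.
  by apply: le_trans (expR_ge1Dx y); rewrite lerDr.
rewrite ge0_integralZl//.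
- by rewrite integral_normal_pdf mule1 ltry.
- by apply/measurable_EFinP; exact: measurable_normal_pdf.
- by move=> x _; rewrite lee_fin normal_pdf_ge0.
Qed.

Lemma normal_prob_second_moment (s : R) : 0 < s ->
  (\int[normal_prob 0 s]_x (x ^+ 2)%:E = (s ^+ 2)%:E * gauss_var)%E.
Proof.
move=> s0; rewrite ge0_integral_normal_prob; last 2 first.
- by apply/measurable_EFinP; exact: measurable_funX.
- by move=> x; rewrite lee_fin sqr_ge0.
under eq_integral do rewrite -EFinM.
pose F (y : R^o) := s * y.
have F'E : F^`()%classic = cst s.
  apply/funext => y; rewrite /F derive1E deriveM// derive_cst scaler0 addr0.
  by rewrite derive_id -[LHS]/(s * 1) mulr1.
rewrite (@increasing_ge0_integration_by_substitutionT R F)/=.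
- rewrite F'E -ge0_integralZl//.
  + apply: eq_integral => y _; rewrite -EFinM; congr EFin.
    rewrite -[LHS]/((s * y) ^+ 2 * normal_pdf 0 s (s * y) * s).
    by rewrite -(normal_pdf_scale y s0); ring.
  + apply/measurable_EFinP; apply: measurable_funM; last exact: measurable_normal_pdf.
    exact: measurable_funX.
  + by move=> x _; rewrite lee_fin mulr_ge0 ?sqr_ge0 ?normal_pdf_ge0.
  + by rewrite lee_fin sqr_ge0.
- by move=> x y xy; rewrite /F ltr_pM2l.
- by rewrite F'E => ?; exact: cvg_cst.
- by rewrite F'E; exact: is_cvg_cst.
- by rewrite F'E; exact: is_cvg_cst.
- by [].
- exact/gt0_cvgMrNy.
- exact/gt0_cvgMry.
- move=> x; apply: (@cvgM R R^o (nbhs x)); first exact: exprn_continuous.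
  by apply: (@continuous_normal_pdf R 0 s); rewrite gt_eqF.
- by move=> x; rewrite mulr_ge0 ?sqr_ge0 ?normal_pdf_ge0.
Qed.

End Gaussian.

Section HasIntegral.
Context {d : measure_display} {T : measurableType d} {R : realType}.
Variables (mu : {measure set T -> \bar R}) (D : set T).
Hypothesis mD : measurable D.
Implicit Types f g : T -> R.

(** Integrability and value travel together, so that an expanded square of a sum can be integrated
    term by term with no separate integrability argument. *)
Definition has_integral f (m : R) :=
  mu.-integrable D (EFin \o f) /\ (\int[mu]_(x in D) (f x)%:E = m%:E)%E.

Lemma has_integral_eq f g m : (forall x, D x -> f x = g x) ->
  has_integral f m -> has_integral g m.
Proof.
move=> fg [fi fm]; split.
  by apply: eq_integrable fi => // x /set_mem Dx /=; rewrite fg.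
by rewrite -fm; apply: eq_integral => x /set_mem Dx; rewrite fg.
Qed.

Lemma has_integralD f g m n : has_integral f m -> has_integral g n ->
  has_integral (fun x => f x + g x) (m + n).
Proof.
move=> [fi fm] [gi gn]; split; first exact: (integrableD mD fi gi).
by rewrite EFinD -fm -gn -integralD_EFin.
Qed.

Lemma has_integralZ c f m : has_integral f m ->
  has_integral (fun x => c * f x) (c * m).
Proof.
move=> [fi fm]; split; first exact: (integrableZl mD c fi).
by rewrite EFinM -fm -integralZl.
Qed.

Lemma has_integral0 : has_integral (fun=> 0) 0.
Proof. by split; [exact: integrable0|exact: integral0]. Qed.

Lemma has_integral_sum (I : Type) (r : seq I) (f : I -> T -> R) (m : I -> R) :
  (forall i, has_integral (f i) (m i)) ->
  has_integral (fun x => \sum_(i <- r) f i x) (\sum_(i <- r) m i).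
Proof.
move=> fm; elim: r => [|i r IH].
  rewrite big_nil; apply: has_integral_eq has_integral0 => x _.
  by rewrite big_nil.
rewrite big_cons; apply: has_integral_eq (has_integralD (fm i) IH) => x _.
by rewrite big_cons.
Qed.

Lemma integrable_has_integral f : mu.-integrable D (EFin \o f) ->
  exists m, has_integral f m.
Proof.
move=> fi; exists (fine (\int[mu]_(x in D) (f x)%:E)); split => //.
by rewrite fineK//; exact: integrable_fin_num fi.
Qed.

End HasIntegral.

(** * Covariances of Brownian increments with coefficients from the past *)

Section ScalarBrownian.
Context {R : realType} {dOm : measure_display} {Om : measurableType dOm}.
Variable P : probability Om R.
Implicit Types (F : R -> set (set Om)) (B : R -> Om -> R) (x y z : Om -> R).

Definition fmeas (G : set (set Om)) x :=
  forall C : set (measurableTypeR R), measurable C -> G (x @^-1` C).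

(** A sigma-algebra equals the one it generates, so on [g_sigma_algebraType G] the usual closure
    properties of measurable functions become available for [fmeas]. *)
Lemma fmeasP (G : set (set Om)) x : sigma_algebra setT G ->
  fmeas G x <-> measurable_fun setT (x : g_sigma_algebraType G -> measurableTypeR R).
Proof.
move=> sG; split=> mx.
  by move=> _ C mC; rewrite setTI /measurable/= sigma_algebra_id//; exact: mx.
by move=> C mC; have := mx measurableT C mC; rewrite setTI /measurable/= sigma_algebra_id.
Qed.

Lemma fmeasM (G : set (set Om)) x y : sigma_algebra setT G ->
  fmeas G x -> fmeas G y -> fmeas G (fun w => x w * y w).
Proof.
by move=> sG /fmeasP-/(_ sG) mx /fmeasP-/(_ sG) my; apply/fmeasP => //; exact: measurable_funM.
Qed.

Lemma fmeasB (G : set (set Om)) x y : sigma_algebra setT G ->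
  fmeas G x -> fmeas G y -> fmeas G (fun w => x w - y w).
Proof.
by move=> sG /fmeasP-/(_ sG) mx /fmeasP-/(_ sG) my; apply/fmeasP => //; exact: measurable_funB.
Qed.

Lemma fmeas_measurable (G : set (set Om)) x : G `<=` measurable -> fmeas G x ->
  measurable_fun setT (x : Om -> measurableTypeR R).
Proof. by move=> Gm mx _ C mC; rewrite setTI; apply: Gm; exact: mx. Qed.

Definition scalar_brownian F B :=
  [/\ forall t, 0 <= t -> fmeas (F t) (B t),
      forall s t, 0 <= s -> s < t -> forall C : set (measurableTypeR R), measurable C ->
        P [set w | C (B t w - B s w)] = normal_prob 0 (Num.sqrt (t - s)) C &
      forall s t, 0 <= s -> s < t -> forall (A : set Om) (C : set (measurableTypeR R)),
        F s A -> measurable C ->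
        P (A `&` [set w | C (B t w - B s w)]) =
        (P A * P [set w | C (B t w - B s w)%R])%E].

Variables (F : R -> set (set Om)) (B : R -> Om -> R).
Hypotheses (hF : filtration F) (hB : scalar_brownian F B).

Let sF t : 0 <= t -> sigma_algebra setT (F t). Proof. by case: hF => + _ _; apply. Qed.
Let Fm t : 0 <= t -> F t `<=` measurable. Proof. by case: hF => _ + _; apply. Qed.

Lemma fmeas_le s t x : 0 <= s -> s <= t -> fmeas (F s) x -> fmeas (F t) x.
Proof. by move=> s0 st mx C mC; case: hF => _ _ /(_ s t s0 st); apply; exact: mx. Qed.

Let Bmeas t : 0 <= t -> fmeas (F t) (B t). Proof. by case: hB => + _ _; apply. Qed.

Let incrF s t : 0 <= s -> s <= t -> fmeas (F t) (fun w => B t w - B s w).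
Proof.
move=> s0 st; have t0 := le_trans s0 st.
by apply: fmeasB; [exact: sF|exact: Bmeas|apply: fmeas_le (Bmeas s0)].
Qed.

Let incr_meas s t : 0 <= s -> s <= t ->
  measurable_fun setT ((fun w => B t w - B s w) : Om -> measurableTypeR R).
Proof.
by move=> s0 st; apply: (fmeas_measurable (Fm (le_trans s0 st))); exact: incrF.
Qed.

Let ge0_integral_incr s t (f : R -> \bar R) : 0 <= s -> s < t ->
  measurable_fun setT f -> (forall u, 0 <= f u)%E ->
  (\int[P]_w f (B t w - B s w)%R = \int[normal_prob 0 (Num.sqrt (t - s)%R)]_u f u)%E.
Proof.
move=> s0 st mf f0.
pose U : {mfun Om >-> measurableTypeR R} := HB.pack (fun w => B t w - B s w)
  (isMeasurableFun.Build _ _ Om (measurableTypeR R) (fun w => B t w - B s w)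
    (incr_meas s0 (ltW st))).
rewrite -(ge0_integral_distribution U)//; apply: eq_measure_integral => A mA _.
by case: hB => _ law _; rewrite -[RHS](law s t s0 st A mA).
Qed.

Definition gvar : R := fine (@gauss_var R).

Lemma gvar_ge0 : 0 <= gvar.
Proof.
apply: fine_ge0; apply: integral_ge0 => x _.
by rewrite lee_fin mulr_ge0 ?sqr_ge0 ?normal_pdf_ge0.
Qed.

Lemma incr_sqr s t : 0 <= s -> s <= t ->
  has_integral P setT (fun w => (B t w - B s w) ^+ 2) (gvar * (t - s)).
Proof.
move=> s0; rewrite le_eqVlt => /predU1P[<-|st].
  rewrite subrr mulr0; apply: has_integral_eq (has_integral0 _ _) => // w _.
  by rewrite subrr expr0n.
have E : (\int[P]_w ((B t w - B s w) ^+ 2)%:E = (gvar * (t - s))%:E)%E.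
  rewrite (@ge0_integral_incr s t (fun u => (u ^+ 2)%:E))//; last 2 first.
  - by apply/measurable_EFinP; exact: measurable_funX.
  - by move=> u; rewrite lee_fin sqr_ge0.
  have h : 0 < Num.sqrt (t - s) by rewrite sqrtr_gt0 subr_gt0.
  rewrite normal_prob_second_moment// sqr_sqrtr ?subr_ge0 ?(ltW st)// muleC.
  by rewrite EFinM fineK ?gauss_var_fin.
split => //; apply: integrable_ge0_ltey => /=.
- by apply/measurable_EFinP; apply: measurable_funX; apply: incr_meas (ltW st).
- by move=> w; rewrite lee_fin sqr_ge0.
- by rewrite E ltry.
Qed.

(** By symmetry of the Gaussian density the positive and negative parts have equal integrals, so no
    first moment is computed. Integrability comes from [|u| <= 1 + u^2] and the second moment. *)
Lemma incr_mean s t : 0 <= s -> s <= t ->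
  has_integral P setT (fun w => B t w - B s w) 0.
Proof.
move=> s0; rewrite le_eqVlt => /predU1P[<-|st].
  by apply: has_integral_eq (has_integral0 _ _) => // w _; rewrite subrr.
have mI := incr_meas s0 (ltW st).
have intB : P.-integrable setT (EFin \o (fun w => B t w - B s w)).
  have [i2 _] := incr_sqr s0 (ltW st).
  apply: (@le_integrable _ _ _ P setT measurableT _
      (EFin \o (fun w => 1 + (B t w - B s w) ^+ 2))).
  - exact/measurable_EFinP.
  - move=> w _ /=; rewrite lee_fin; set u := B t w - B s w.
    rewrite [leRHS]ger0_norm ?addr_ge0 ?sqr_ge0//.
    by rewrite ler_norml; apply/andP; split; nra.
  - have i1 : has_integral P setT (fun=> 1) 1.
      split; first exact: finite_measure_integrable_cst.
      by rewrite -[LHS]/(\int[P]_x cst 1 x)%E integral_cst //= probability_setT mule1.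
    by have [] := has_integralD measurableT i1 (incr_sqr s0 (ltW st)).
split => //; rewrite integralE.
pose f (u : R) := (Num.max u 0)%:E.
have mf : measurable_fun setT f by apply/measurable_EFinP; exact: measurable_maxr.
have f0 u : (0 <= f u)%E by rewrite lee_fin le_max lexx orbT.
have posE : (\int[P]_w (fun w => (B t w - B s w)%R%:E)^\+ w =
             \int[P]_w f (B t w - B s w)%R)%E.
  by apply: eq_integral => w _; rewrite funeposE /f EFin_max.
have negE : (\int[P]_w (fun w => (B t w - B s w)%R%:E)^\- w =
             \int[P]_w f (- (B t w - B s w)%R)%R)%E.
  by apply: eq_integral => w _; rewrite funenegE /f EFin_max.
rewrite posE negE (@ge0_integral_incr s t f)//.
rewrite (@ge0_integral_incr s t (fun u => f (- u)))//; last first.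
  exact: measurableT_comp.
have -> : (\int[normal_prob 0 (Num.sqrt (t - s)%R)]_u f (- u)%R =
           \int[normal_prob 0 (Num.sqrt (t - s)%R)]_u f u)%E.
  have h : 0 < Num.sqrt (t - s) by rewrite sqrtr_gt0 subr_gt0.
  have mpdf : measurable_fun setT (fun u => (normal_pdf 0 (Num.sqrt (t - s)) u)%:E).
    by apply/measurable_EFinP; exact: measurable_normal_pdf.
  rewrite !ge0_integral_normal_prob//; last exact: measurableT_comp.
  pose g u := (f u * (normal_pdf 0 (Num.sqrt (t - s)%R) u)%:E)%E.
  have mg : measurable_fun setT g by exact: emeasurable_funM.
  have mN : measurable_fun setT (-%R : measurableTypeR R -> measurableTypeR R).
    exact: oppr_measurable.
  have g0 : {in [set: measurableTypeR R], forall u, (0 <= g u)%E}.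
    by move=> u _; rewrite mule_ge0// lee_fin normal_pdf_ge0.
  have E := ge0_integral_pushforward mN lebesgue_measure measurableT mg g0.
  transitivity (\int[lebesgue_measure]_u g (- u)%R)%E.
    by apply: eq_integral => u _; rewrite /g normal_pdfN.
  apply: etrans (esym E) _.
  by apply: eq_measure_integral => //= A mA _; exact: lebesgue_measureN.
rewrite -(@ge0_integral_incr s t f)// -posE subee//.
exact: integrable_pos_fin_num.
Qed.

Let EP := has_integral P setT.

(** Only integrability of [z] is required, not boundedness: [z] may itself contain earlier
    increments, which lets [past_incrM] be iterated. *)
Lemma mean_past_incr s t z m : 0 <= s -> s <= t -> fmeas (F s) z -> EP z m ->
  EP (fun w => z w * (B t w - B s w)) 0.
Proof.
move=> s0; rewrite le_eqVlt => /predU1P[<- _ _|st zF [zi zm]].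
  by apply: has_integral_eq (has_integral0 _ _) => // w _; rewrite subrr mulr0.
have [bi b0] := incr_mean s0 (ltW st).
have ind (A C : set (measurableTypeR R)) : measurable A -> measurable C ->
    P (z @^-1` A `&` (fun w => B t w - B s w) @^-1` C) =
    (P (z @^-1` A) * P ((fun w => (B t w - B s w)%R) @^-1` C))%E.
  by move=> mA mC; case: hB => _ _; apply => //; exact: zF.
have [zbi zbm] := indep_expectationM ind zi bi.
by split => //; rewrite zbm zm b0 mule0.
Qed.

Lemma mean_past_incr_sqr s t z m : 0 <= s -> s <= t -> fmeas (F s) z -> EP z m ->
  EP (fun w => z w * (B t w - B s w) ^+ 2) (gvar * (t - s) * m).
Proof.
move=> s0; rewrite le_eqVlt => /predU1P[<- _ _|st zF [zi zm]].
  rewrite subrr mulr0 mul0r; apply: has_integral_eq (has_integral0 _ _) => // w _.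
  by rewrite subrr expr0n mulr0.
have [bi b0] := incr_sqr s0 (ltW st).
have ind (A C : set (measurableTypeR R)) : measurable A -> measurable C ->
    P (z @^-1` A `&` (fun w => (B t w - B s w) ^+ 2) @^-1` C) =
    (P (z @^-1` A) * P ((fun w => (B t w - B s w) ^+ 2)%R @^-1` C))%E.
  move=> mA mC; case: hB => _ _ /(_ s t s0 st (z @^-1` A)
    ((fun u : measurableTypeR R => (u ^+ 2 : measurableTypeR R)) @^-1` C)); apply; first exact: zF.
  have m2 : measurable_fun setT (fun u : measurableTypeR R => (u ^+ 2 : measurableTypeR R)).
    exact: measurable_funX.
  by rewrite -[X in measurable X]setTI; exact: m2.
have [zbi zbm] := indep_expectationM ind zi bi.
by split => //; rewrite zbm zm b0 -EFinM mulrC.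
Qed.

Definition bounded_past (s : R) x := fmeas (F s) x /\ exists c, forall w, `|x w| <= c.

Lemma bounded_past_has_integral s x : 0 <= s -> bounded_past s x -> exists m, EP x m.
Proof.
move=> s0 [xF [c xc]]; apply: integrable_has_integral => //.
apply: (@le_integrable _ _ _ P setT measurableT _ (EFin \o cst c)).
- by apply/measurable_EFinP; apply: (fmeas_measurable (Fm s0)).
- by move=> w _ /=; rewrite lee_fin (le_trans (xc w))// ler_norm.
- exact: finite_measure_integrable_cst.
Qed.

Lemma bounded_pastM s x y : 0 <= s -> bounded_past s x -> bounded_past s y ->
  bounded_past s (fun w => x w * y w).
Proof.
move=> s0 [xF [c xc]] [yF [e ye]]; split; first exact: fmeasM (sF s0) xF yF.
by exists (c * e) => w; rewrite normrM ler_pM.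
Qed.

Lemma bounded_past_le s t x : 0 <= s -> s <= t -> bounded_past s x -> bounded_past t x.
Proof. by move=> s0 st [xF xc]; split => //; apply: fmeas_le xF. Qed.

Lemma past_incrM s t x m : 0 <= s -> s <= t -> fmeas (F s) x -> EP x m ->
  fmeas (F t) (fun w => x w * (B t w - B s w)) /\
  EP (fun w => x w * (B t w - B s w)) 0.
Proof.
move=> s0 st xF xm; split; last exact: mean_past_incr xm.
by apply: fmeasM (sF (le_trans s0 st)) _ (incrF s0 st); exact: fmeas_le xF.
Qed.

(** The length of the intersection of []a, b]] and []c, d]]; the maximum with 0 covers disjoint
    intervals. *)
Definition overlap (a b c d : R) := Num.max 0 (Num.min b d - Num.max a c).

(** The longer increment is cut at [b]: its first piece produces the square of the shorter
    increment, its second piece lies in the future of everything else and contributes 0. *)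
Let cov_same_start_le a b d x y m : 0 <= a -> a <= b -> b <= d ->
  bounded_past a x -> bounded_past a y -> EP (fun w => x w * y w) m ->
  EP (fun w => (x w * (B b w - B a w)) * (y w * (B d w - B a w)))
     (gvar * (b - a) * m).
Proof.
move=> a0 ab bd xa ya xym.
have b0 := le_trans a0 ab.
have [xyF _] := bounded_pastM a0 xa ya.
have [xyBF xyB0] := past_incrM a0 ab xyF xym.
have [_ H2] := past_incrM b0 bd xyBF xyB0.
have H1 := mean_past_incr_sqr a0 ab xyF xym.
rewrite -[X in EP _ X]addr0.
by apply: has_integral_eq (has_integralD measurableT H1 H2) => // w _ /=; ring.
Qed.

Let cov_same_start a b d x y m : 0 <= a -> a <= b -> a <= d ->
  bounded_past a x -> bounded_past a y -> EP (fun w => x w * y w) m ->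
  EP (fun w => (x w * (B b w - B a w)) * (y w * (B d w - B a w)))
     (gvar * (Num.min b d - a) * m).
Proof.
move=> a0 ab ad xa ya xym; have [bd|/ltW db] := leP b d.
  exact: cov_same_start_le.
have yxm : EP (fun w => y w * x w) m.
  by apply: has_integral_eq xym => // w _; rewrite mulrC.
by apply: has_integral_eq (cov_same_start_le a0 ad db ya xa yxm) => // w _; rewrite mulrC.
Qed.

Let cov_ordered a b c d x y m : 0 <= a -> a <= b -> c <= d -> a <= c ->
  bounded_past a x -> bounded_past c y -> EP (fun w => x w * y w) m ->
  EP (fun w => (x w * (B b w - B a w)) * (y w * (B d w - B c w)))
     (gvar * overlap a b c d * m).
Proof.
move=> a0 ab cd ac xa yc xym; have c0 := le_trans a0 ac; rewrite /overlap.
rewrite (max_r ac).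
(* [x (B e - B a) y] is F_c-measurable, so its product with an increment
   after time [c] is centred. *)
have ortho e : a <= e -> e <= c ->
    EP (fun w => (x w * (B e w - B a w) * y w) * (B d w - B c w)) 0.
  move=> ae ec; have e0 := le_trans a0 ae.
  have [m' xm] := bounded_past_has_integral a0 xa.
  have [xBF [xBi _]] := past_incrM a0 ae (proj1 xa) xm.
  have [yF [k yk]] := yc.
  have xByF : fmeas (F c) (fun w => x w * (B e w - B a w) * y w).
    by apply: fmeasM (sF c0) _ yF; apply: fmeas_le xBF.
  have [m2 H] : exists m, EP (fun w => x w * (B e w - B a w) * y w) m.
    apply: integrable_has_integral => //.
    apply: (@le_integrable _ _ _ P setT measurableT _
      (EFin \o (fun w => k * (x w * (B e w - B a w))))).
    - by apply/measurable_EFinP; apply: (fmeas_measurable (Fm c0)).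
    - move=> w _ /=; rewrite lee_fin mulrC !(normrM k) normrM ler_wpM2r//.
      by rewrite (le_trans (yk w))// ler_norm.
    - exact: (integrableZl measurableT k xBi).
  exact: mean_past_incr H.
have [bc|/ltW cb] := leP b c.
  rewrite max_l; last by rewrite subr_le0 (le_trans _ bc)// ge_min lexx.
  rewrite mulr0 mul0r; apply: has_integral_eq (ortho b ab bc) => // w _; ring.
rewrite max_r ?subr_ge0 ?le_min ?cb//.
(* The first increment is cut at [c]: the piece before [c] is handled by [ortho], and the piece
   after it shares its starting time with the second increment. *)
have H := cov_same_start c0 cb cd (bounded_past_le a0 ac xa) yc xym.
rewrite -[X in EP _ X]add0r.
apply: has_integral_eq (has_integralD measurableT (ortho c ac (lexx c)) H) => // w _ /=.
ring.
Qed.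

(** This is the isometry in polarised form. Attached to pairs of intervals in arbitrary position, it
    allows squaring a sum over any finite family of intervals. *)
Lemma cov_incr a b c d x y m : 0 <= a -> a <= b -> 0 <= c -> c <= d ->
  bounded_past a x -> bounded_past c y -> EP (fun w => x w * y w) m ->
  EP (fun w => (x w * (B b w - B a w)) * (y w * (B d w - B c w)))
     (gvar * overlap a b c d * m).
Proof.
move=> a0 ab c0 cd xa yc xym; have [ac|/ltW ca] := leP a c.
  exact: cov_ordered.
have yxm : EP (fun w => y w * x w) m.
  by apply: has_integral_eq xym => // w _; rewrite mulrC.
have -> : overlap a b c d = overlap c d a b by rewrite /overlap minC [Num.max a c]maxC.
by apply: has_integral_eq (cov_ordered c0 cd ab ca yc xa yxm) => // w _; rewrite mulrC.
Qed.

End ScalarBrownian.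

(** * Ito isometry for simple processes *)

(** Cauchy-Schwarz against the constant vector, read off from the expansion of the nonnegative
    double sum of [(a i - a j)^2]. *)
Lemma sqr_sum_le (R : realType) (I : finType) (a : I -> R) :
  (\sum_i a i) ^+ 2 <= #|I|%:R * \sum_i a i ^+ 2.
Proof.
have H : 0 <= \sum_i \sum_j (a i - a j) ^+ 2.
  by apply: sumr_ge0 => i _; apply: sumr_ge0 => j _; rewrite sqr_ge0.
set S := \sum_i a i; set S2 := \sum_i a i ^+ 2; set n := #|I|%:R.
suff E : \sum_i \sum_j (a i - a j) ^+ 2 = n * S2 - 2 * S * S + n * S2.
  move: H; rewrite E -[2 * S * S]mulrA -expr2 -/S -/S2 -/n; lra.
have E i : \sum_j (a i - a j) ^+ 2 = n * a i ^+ 2 - (2 * S) * a i + S2.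
  rewrite (eq_bigr (fun j => a i ^+ 2 + ((- 2 * a i) * a j + a j ^+ 2))); last first.
    by move=> j _; ring.
  rewrite !big_split /= sumr_const -mulr_sumr -mulr_natl -/S -/S2 -/n; ring.
rewrite (eq_bigr _ (fun i _ => E i)) big_split sumrB -!mulr_sumr /=.
by rewrite sumr_const -[S2 *+ _]mulr_natl.
Qed.

(** * Inequalities for the Frobenius norm *)

Section Frob.
Context {R : realType}.

Lemma frob_sq (m n : nat) (A : 'M[R]_(m, n)) :
  frob A ^+ 2 = \sum_i \sum_j A i j ^+ 2.
Proof.
by rewrite /frob sqr_sqrtr// !sumr_ge0// => i _; rewrite sumr_ge0// => j _; rewrite sqr_ge0.
Qed.

Lemma frob_ge0 (m n : nat) (A : 'M[R]_(m, n)) : 0 <= frob A.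
Proof. exact: sqrtr_ge0. Qed.

Lemma frob0 (m n : nat) : frob (0 : 'M[R]_(m, n)) = 0.
Proof.
apply/eqP; rewrite -sqrf_eq0 frob_sq big1// => i _; rewrite big1// => j _.
by rewrite mxE expr0n.
Qed.

Lemma frobN (m n : nat) (A : 'M[R]_(m, n)) : frob (- A) = frob A.
Proof.
rewrite /frob; congr Num.sqrt; apply: eq_bigr => i _; apply: eq_bigr => j _.
by rewrite mxE sqrrN.
Qed.

Lemma frob_sqD (m n : nat) (A B : 'M[R]_(m, n)) :
  frob (A + B) ^+ 2 <= 2 * frob A ^+ 2 + 2 * frob B ^+ 2.
Proof.
rewrite !frob_sq !mulr_sumr -big_split; apply: ler_sum => i _ /=.
rewrite !mulr_sumr -big_split; apply: ler_sum => j _ /=.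
rewrite mxE -subr_ge0 (_ : _ - _ = (A i j - B i j) ^+ 2) ?sqr_ge0//; ring.
Qed.

Lemma frob_sqB (m n : nat) (A B : 'M[R]_(m, n)) :
  frob (A - B) ^+ 2 <= 2 * frob A ^+ 2 + 2 * frob B ^+ 2.
Proof. by rewrite -[frob B]frobN frob_sqD. Qed.

Lemma frob_sqD3 (m n : nat) (A B C : 'M[R]_(m, n)) :
  frob (A + B + C) ^+ 2 <= 3 * frob A ^+ 2 + 3 * frob B ^+ 2 + 3 * frob C ^+ 2.
Proof.
rewrite !frob_sq !mulr_sumr -!big_split; apply: ler_sum => i _ /=.
rewrite !mulr_sumr -!big_split; apply: ler_sum => j _ /=.
rewrite !mxE -subr_ge0.
rewrite (_ : _ - _ = (A i j - B i j) ^+ 2 + (B i j - C i j) ^+ 2 +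
  (A i j - C i j) ^+ 2); last by ring.
by rewrite !addr_ge0 ?sqr_ge0.
Qed.

Lemma frob_entry (m n : nat) (A : 'M[R]_(m, n)) i j : `|A i j| <= frob A.
Proof.
rewrite -(@ler_pXn2r _ 2)// ?nnegrE ?normr_ge0 ?frob_ge0// frob_sq real_normK ?num_real//.
rewrite (bigD1 i)//= (bigD1 j)//= -addrA lerDl addr_ge0 ?sumr_ge0// => k _.
  exact: sqr_ge0.
by rewrite sumr_ge0// => l _; rewrite sqr_ge0.
Qed.

(** The factor [n] is the price of applying [sqr_sum_le] to each entry; the sharp inequality has
    none, but constants are free here. *)
Lemma frob_sqM (m n p : nat) (A : 'M[R]_(m, n)) (B : 'M[R]_(n, p)) :
  frob (A *m B) ^+ 2 <= n%:R * (frob A ^+ 2 * frob B ^+ 2).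
Proof.
apply: (@le_trans _ _ (\sum_i \sum_j n%:R * \sum_k A i k ^+ 2 * B k j ^+ 2)).
  rewrite frob_sq; apply: ler_sum => i _; apply: ler_sum => j _; rewrite mxE.
  apply: le_trans (sqr_sum_le _) _; rewrite card_ord.
  by under eq_bigr do rewrite exprMn.
under eq_bigr do rewrite -mulr_sumr; rewrite -mulr_sumr ler_wpM2l//.
rewrite frob_sq mulr_suml; apply: ler_sum => i _.
rewrite exchange_big /= mulr_suml; apply: ler_sum => k _.
rewrite -mulr_sumr ler_wpM2l ?sqr_ge0// frob_sq.
rewrite [leRHS](bigD1 k)//= lerDl sumr_ge0// => l _.
by rewrite sumr_ge0// => j _; rewrite sqr_ge0.
Qed.

End Frob.

Section Elementary.
Context {R : realType} {dOm : measure_display} {Om : measurableType dOm}.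
Variable P : probability Om R.
Variables (F : R -> set (set Om)).
Hypotheses (hF : filtration F).
Local Notation leb := (@lebesgue_measure R).

Lemma has_integral_overlap (t a b c d : R) : 0 <= a -> a <= b -> b <= t ->
  0 <= c -> c <= d -> d <= t ->
  has_integral leb `[0, t]
    (fun s => (\1_(`]a, b] : set R) s : R) * (\1_(`]c, d] : set R) s : R))
    (overlap a b c d).
Proof.
move=> a0 ab bt c0 cd dt.
set E : set (measurableTypeR R) := `]Num.max a c, Num.min b d]%classic.
have EE : E `<=` `[0, t]%classic.
  move=> s; rewrite /E /= !in_itv /= gt_max le_min => /andP[/andP[a1 _] /andP[b1 _]].
  by rewrite (ltW (le_lt_trans a0 a1)) (le_trans b1 bt).
have mE : measurable E by exact: measurable_itv.
have lE : leb E = (overlap a b c d)%:E.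
  rewrite /E lebesgue_measure_itv /= lte_fin /overlap.
  have [h|h] := ltP (Num.max a c) (Num.min b d).
    by rewrite [Num.max 0 _]max_r ?subr_ge0 ?(ltW h)// EFinB.
  by rewrite [Num.max 0 _]max_l ?subr_le0.
apply: (@has_integral_eq _ _ _ _ _ _ (fun s => \1_E s)) => //.
  move=> s _; rewrite !indicE -natrM mulnb -in_setI; congr ((_ \in _)%:R).
  apply/seteqP; split=> u; rewrite /E /= !in_itv /= gt_max le_min.
    by move=> /andP[/andP[-> ->] /andP[-> ->]].
  by move=> [/andP[-> ->] /andP[-> ->]].
have iE : (\int[leb]_(s in `[0%R, t]) (\1_E s)%:E = (overlap a b c d)%:E)%E.
  by rewrite integral_indic// setIidl.
split=> //; apply/integrableP; split.
  by apply/measurable_EFinP; exact: measurable_indic.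
under eq_integral do rewrite gee0_abs ?lee_fin//.
by rewrite iE ltry.
Qed.

(* The intervals may overlap, so the difference of two simple integrals over
   different partitions is covered without a common refinement. *)
Lemma elementary_isometry (B : R -> Om -> R) (t : R) (I : finType)
    (a b : I -> R) (x : I -> Om -> R) :
  scalar_brownian P F B ->
  (forall i, [/\ 0 <= a i, a i <= b i, b i <= t & bounded_past F (a i) (x i)]) ->
  exists M h,
  [/\ has_integral P setT
        (fun w => (\sum_i x i w * (B (b i) w - B (a i) w)) ^+ 2) (gvar * M),
      forall w, has_integral leb `[0, t]
        (fun s => (\sum_i (\1_(`]a i, b i] : set R) s : R) * x i w) ^+ 2) (h w) &
      has_integral P setT h M].
Proof.
move=> hB hab.
have /choice[m mE] : forall ij : I * I, exists m,
    has_integral P setT (fun w => x ij.1 w * x ij.2 w) m.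
  move=> [i j] /=; have [ai _ _ xi] := hab i; have [aj _ _ xj] := hab j.
  have [ij|/ltW ji] := leP (a i) (a j).
    apply: (bounded_past_has_integral P hF aj); apply: bounded_pastM => //.
    exact: bounded_past_le xi.
  apply: (bounded_past_has_integral P hF ai); apply: bounded_pastM => //.
  exact: bounded_past_le xj.
pose ov i j := overlap (a i) (b i) (a j) (b j).
(* Both sides of the isometry expand to this sum of overlaps weighted by the mixed moments of the
   coefficients, up to the factor [gvar] on the stochastic side. *)
exists (\sum_i \sum_j ov i j * m (i, j)).
exists (fun w => \sum_i \sum_j ov i j * (x i w * x j w)); split.
- rewrite mulr_sumr; under eq_bigr do rewrite mulr_sumr.
  apply: (@has_integral_eq _ _ _ _ _ _ (fun w => \sum_i \sum_j
     (x i w * (B (b i) w - B (a i) w)) * (x j w * (B (b j) w - B (a j) w)))) => //.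
    by move=> w _; rewrite expr2 mulr_suml; apply: eq_bigr => i _; rewrite mulr_sumr.
  apply: has_integral_sum => // i; apply: has_integral_sum => // j.
  rewrite mulrA; have [ai abi bi xi] := hab i; have [aj abj bj xj] := hab j.
  exact: (cov_incr hF hB ai abi aj abj xi xj (mE (i, j))).
- move=> w.
  have H : has_integral leb `[0, t] (fun s => \sum_i \sum_j (x i w * x j w) *
      ((\1_(`]a i, b i] : set R) s : R) * (\1_(`]a j, b j] : set R) s : R)))
      (\sum_i \sum_j (x i w * x j w) * ov i j).
    apply: has_integral_sum => // i; apply: has_integral_sum => // j.
    have [ai abi bi xi] := hab i; have [aj abj bj xj] := hab j.
    by apply: has_integralZ => //; exact: has_integral_overlap.
  under eq_bigr do under eq_bigr do rewrite mulrC.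
  apply: has_integral_eq H => // s _; rewrite expr2 mulr_suml.
  apply: eq_bigr => i _; rewrite mulr_sumr.
  by apply: eq_bigr => j _; ring.
- apply: has_integral_sum => // i; apply: has_integral_sum => // j.
  by apply: has_integralZ => //; exact: mE (i, j).
Qed.

Lemma brownian_coord (d : nat) (W : R -> Om -> 'cV[R]_d) (j : 'I_d) :
  brownian_motion P F W -> scalar_brownian P F (fun t w => W t w j ord0).
Proof.
move=> [ad _ _ law ind]; split.
- by move=> t t0 C mC; exact: ad.
- by move=> s t s0 st C mC; rewrite -(law s t s0 st j C mC).
- move=> s t s0 st A C FA mC.
  (* The full line as target set for the other coordinates turns their factors in the product into
     1. *)
  pose BB (l : 'I_d) : set (measurableTypeR R) := if l == j then C else setT.
  have mBB l : measurable (BB l) by rewrite /BB; case: ifP.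
  have E : [set w | forall l, BB l (W t w l ord0 - W s w l ord0)] =
           [set w | C (W t w j ord0 - W s w j ord0)].
    apply/seteqP; split=> w /=; first by move/(_ j); rewrite /BB eqxx.
    by move=> Cw l; rewrite /BB; case: eqP => // ->.
  have := ind s t s0 st A BB FA mBB; rewrite E => ->.
  rewrite (bigD1 j)//= {1}/BB eqxx big1 ?mule1// => l lj.
  by rewrite /BB (negbTE lj) -[RHS](probability_setT P).
Qed.

End Elementary.

(** * Estimate for Ito integrals *)

Section MxMeasurable.
Context {R : realType} {d : measure_display} {T : measurableType d}.
Variables (m n : nat) (D : set T).
Implicit Types f g : T -> 'M[R]_(m, n).

Lemma mx_measurableB f g : mx_measurable D f -> mx_measurable D g ->
  mx_measurable D (fun x => f x - g x).
Proof.
move=> mf mg i j; under eq_fun do rewrite !mxE.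
by apply: measurable_funB; [exact: mf|exact: mg].
Qed.

Lemma mx_measurable_frob_sq f : mx_measurable D f ->
  measurable_fun D (fun x => (frob (f x) ^+ 2)%:E).
Proof.
move=> mf; apply/measurable_EFinP; under eq_fun do rewrite frob_sq.
apply: measurable_sum => i; apply: measurable_sum => j.
by apply: measurable_funX; exact: mf.
Qed.

End MxMeasurable.

(** * Iterated integrals over time and probability *)

Section DoubleIntegral.
Context {R : realType} {dOm : measure_display} {Om : measurableType dOm}.
Variables (P : probability Om R) (t : R).
Local Notation leb := (@lebesgue_measure R).
Implicit Types f g : R -> Om -> \bar R.
Local Open Scope ereal_scope.

Definition slab : set (measurableTypeR R * Om) := `[0%R, t] `*` setT.

Definition slab_nonneg f :=
  measurable_fun slab (fun p => f p.1 p.2) /\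
  forall s w, (0 <= s <= t)%R -> 0 <= f s w.

Definition slab_integral f := \int[P]_w \int[leb]_(s in `[0%R, t]) f s w.

(** Measurability is known on the slab only, while Tonelli is applied on the whole product space;
    extension by zero bridges the two. *)
Let slab_ext f (p : measurableTypeR R * Om) := ((fun p => f p.1 p.2) \_ slab) p.

Let mslab : measurable slab.
Proof. by apply: measurableX => //; exact: measurable_itv. Qed.

Let slab_extE f s w : slab_ext f (s, w) = ((f ^~ w) \_ `[0%R, t]) s.
Proof.
rewrite /slab_ext !patchE; have -> // : ((s, w) \in slab) = (s \in `[0%R, t]%classic).
by apply/idP/idP => /set_mem h; apply/mem_set; [case: h|split].
Qed.

Let slab_ext_ge0 f : slab_nonneg f -> forall p, 0 <= slab_ext f p.
Proof.
move=> [_ f0] [s w]; rewrite slab_extE patchE; case: ifPn => // /set_mem.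
by rewrite /= in_itv/= => /f0.
Qed.

Let measurable_slab_ext f : slab_nonneg f -> measurable_fun setT (slab_ext f).
Proof. by move=> [mf _]; apply/(measurable_restrictT _ mslab). Qed.

Let inner_leb f w : \int[leb]_(s in `[0%R, t]) f s w = \int[leb]_s slab_ext f (s, w).
Proof. by rewrite integral_mkcond; apply: eq_integral => s _; rewrite slab_extE. Qed.

Let inner_P f s : (0 <= s <= t)%R -> \int[P]_w f s w = \int[P]_w slab_ext f (s, w).
Proof.
move=> st; apply: eq_integral => w _; by rewrite slab_extE patchE mem_set//= in_itv.
Qed.

Lemma measurable_inner_leb f : slab_nonneg f ->
  measurable_fun setT (fun w => \int[leb]_(s in `[0%R, t]) f s w).
Proof.
move=> hf; under eq_fun do rewrite inner_leb.
by apply: measurable_fun_fubini_tonelli_G; [exact: measurable_slab_ext|exact: slab_ext_ge0].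
Qed.

Lemma measurable_inner_P f : slab_nonneg f ->
  measurable_fun (`[0%R, t] : set (measurableTypeR R)) (fun s => \int[P]_w f s w).
Proof.
move=> hf; apply: (eq_measurable_fun (fun s => \int[P]_w slab_ext f (s, w))).
  by move=> s /set_mem; rewrite /= in_itv/= => /inner_P ->.
apply: measurable_funTS.
by apply: measurable_fun_fubini_tonelli_F; [exact: measurable_slab_ext|exact: slab_ext_ge0].
Qed.

Lemma slab_integral_swap f : slab_nonneg f ->
  slab_integral f = \int[leb]_(s in `[0%R, t]) \int[P]_w f s w.
Proof.
move=> hf; rewrite /slab_integral; under eq_integral do rewrite inner_leb.
rewrite -fubini_tonelli; [|exact: measurable_slab_ext|exact: slab_ext_ge0].
rewrite [RHS]integral_mkcond; apply: eq_integral => s _; rewrite patchE.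
case: ifPn => [/set_mem|st]; first by rewrite /= in_itv/= => /inner_P ->.
rewrite integral0_eq// => w _; rewrite slab_extE patchE; move: st.
by rewrite -[X in (s \in X)]/`[0%R, t]%classic => /negbTE ->.
Qed.

Lemma slab_nonneg_section f w : slab_nonneg f ->
  measurable_fun (`[0%R, t] : set (measurableTypeR R)) (f ^~ w).
Proof.
move=> hf; apply: (eq_measurable_fun (fun s => slab_ext f (s, w))).
  by move=> s st; rewrite slab_extE patchE st.
apply: measurable_funTS; apply: (measurableT_comp (measurable_slab_ext hf)).
exact: measurable_pair2.
Qed.

Lemma slab_nonnegD f g : slab_nonneg f -> slab_nonneg g ->
  slab_nonneg (fun s w => f s w + g s w).
Proof.
move=> [mf f0] [mg g0]; split; first exact: emeasurable_funD.
by move=> s w st; rewrite adde_ge0 ?f0 ?g0.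
Qed.

Lemma slab_nonnegZ c f : 0 <= c -> slab_nonneg f -> slab_nonneg (fun s w => c * f s w).
Proof.
move=> c0 [mf f0]; split; first exact: (emeasurable_funM (measurable_cst c) mf).
by move=> s w st; rewrite mule_ge0 ?f0.
Qed.

Lemma slab_integralD f g : slab_nonneg f -> slab_nonneg g ->
  slab_integral (fun s w => f s w + g s w) = slab_integral f + slab_integral g.
Proof.
move=> hf hg; have [_ f0] := hf; have [_ g0] := hg.
rewrite /slab_integral -ge0_integralD//; last 4 first.
- by move=> w _; apply: integral_ge0 => s; rewrite /= in_itv/=; exact: f0.
- exact: measurable_inner_leb.
- by move=> w _; apply: integral_ge0 => s; rewrite /= in_itv/=; exact: g0.
- exact: measurable_inner_leb.
apply: eq_integral => w _; rewrite ge0_integralD//.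
- by move=> s; rewrite /= in_itv/=; exact: f0.
- exact: slab_nonneg_section.
- by move=> s; rewrite /= in_itv/=; exact: g0.
- exact: slab_nonneg_section.
Qed.

Lemma slab_integralZ c f : 0 <= c -> slab_nonneg f ->
  slab_integral (fun s w => c * f s w) = c * slab_integral f.
Proof.
move=> c0 hf; have [_ f0] := hf.
rewrite /slab_integral -ge0_integralZl//; last 2 first.
- exact: measurable_inner_leb.
- by move=> w _; apply: integral_ge0 => s; rewrite /= in_itv/=; exact: f0.
apply: eq_integral => w _; rewrite ge0_integralZl//.
- exact: slab_nonneg_section.
- by move=> s; rewrite /= in_itv/=; exact: f0.
Qed.

Lemma slab_integral_le f g : (forall s w, (0 <= s <= t)%R -> 0 <= f s w) ->
  (forall s w, (0 <= s <= t)%R -> f s w <= g s w) ->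
  slab_integral f <= slab_integral g.
Proof.
move=> f0 fg; apply: ge0_le_integral_nomeas => w _.
  by apply: integral_ge0 => s; rewrite /= in_itv/=; exact: f0.
by apply: ge0_le_integral_nomeas => s; rewrite /= in_itv/= => st; [exact: f0|exact: fg].
Qed.

Lemma slab_integral_ge0 f : slab_nonneg f -> 0 <= slab_integral f.
Proof.
move=> [_ f0]; apply: integral_ge0 => w _.
by apply: integral_ge0 => s; rewrite /= in_itv/=; exact: f0.
Qed.

End DoubleIntegral.

Section Ito.
Context {R : realType} {dOm : measure_display} {Om : measurableType dOm}.
Variables (P : probability Om R) (d : nat).
Variables (F : R -> set (set Om)) (W : R -> Om -> 'cV[R]_d).
Hypotheses (hF : filtration F) (hW : brownian_motion P F W).
Local Notation leb := (@lebesgue_measure R).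

Lemma slab_nonneg_frob (t : R) (m n : nat) (H : R -> Om -> 'M[R]_(m, n)) :
  mx_measurable (slab t) (fun p => H p.1 p.2) ->
  slab_nonneg t (fun s w => (frob (H s w) ^+ 2)%:E).
Proof.
by move=> mH; split; [exact: mx_measurable_frob_sq|move=> *; rewrite lee_fin sqr_ge0].
Qed.

Let simple_times (t : R) n (tau : nat -> R) (xi : nat -> Om -> 'M[R]_d) :
  is_simple F t n tau xi -> forall k, (k < n)%N ->
  [/\ 0 <= tau k, tau k <= tau k.+1 & tau k.+1 <= t].
Proof.
move=> [tau0 taun tauS _ _].
have mono i j : (i <= j <= n)%N -> tau i <= tau j.
  move=> /andP[]; elim: j => [|j IH]; first by rewrite leqn0 => /eqP ->.
  rewrite leq_eqVlt => /predU1P[->//|ij jn].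
  by apply: le_trans (IH _ (ltnW jn)) (tauS _ jn).
move=> k kn; split; last by rewrite -taun mono// kn /=.
  by rewrite -tau0 mono //= ltnW.
exact: tauS.
Qed.

Let simple_entry (t : R) n (tau : nat -> R) (xi : nat -> Om -> 'M[R]_d) :
  is_simple F t n tau xi -> forall i j k, (k < n)%N ->
  bounded_past F (tau k) (fun w => xi k w i j).
Proof.
move=> [_ _ _ mxi [c xic]] i j k kn; split; first exact: mxi.
by exists c => w; rewrite (le_trans (frob_entry _ i j))// xic.
Qed.

Lemma mx_measurable_simple_process (t : R) n tau xi : is_simple F t n tau xi ->
  mx_measurable (slab t) (fun p => simple_process n tau xi p.1 p.2 : 'M[R]_d).
Proof.
move=> hs i j; apply: measurable_funTS; rewrite /simple_process.
under eq_fun do rewrite summxE.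
apply: measurable_sum => k; under eq_fun do rewrite mxE.
apply: measurable_funM.
  have mi : measurable_fun setT (\1_(`]tau k, tau k.+1]%classic :
      set (measurableTypeR R)) : measurableTypeR R -> R).
    exact: measurable_indic.
  exact: (measurableT_comp mi measurable_fst).
have [tk _ _] := simple_times hs (ltn_ord k).
have [xF _] := simple_entry hs i j (ltn_ord k).
have mx : measurable_fun setT ((fun w => xi k w i j) : Om -> measurableTypeR R).
  by apply: (fmeas_measurable _ xF); case: hF => _ + _; apply.
exact: (measurableT_comp mx measurable_snd).
Qed.

(* Each column of the integrand is integrated against one coordinate of [W], so
   only the independence of that coordinate from the past is needed; summing
   the columns costs the factor [d]. *)
Lemma simple_diff_isometry (t : R) n tau xi n' tau' xi' :
  is_simple F t n tau xi -> is_simple F t n' tau' xi' ->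
  (\int[P]_w (frob (simple_integral W n tau xi w - simple_integral W n' tau' xi' w) ^+ 2)%:E
   <= (d%:R * gvar)%:E * slab_integral P t (fun s w =>
     (frob (simple_process n tau xi s w - simple_process n' tau' xi' s w) ^+ 2)%:E))%E.
Proof.
move=> hs hs'.
(* Indexing by the disjoint union of the two partitions makes the difference of the two simple
   integrals a single elementary sum, with the second coefficients negated. *)
pose a (k : 'I_n + 'I_n') := match k with inl k => tau k | inr k => tau' k end.
pose b (k : 'I_n + 'I_n') := match k with inl k => tau k.+1 | inr k => tau' k.+1 end.
pose x i j (k : 'I_n + 'I_n') w :=
  match k with inl k => xi k w i j | inr k => - xi' k w i j end.
have hab i j k : [/\ 0 <= a k, a k <= b k, b k <= t & bounded_past F (a k) (x i j k)].
  case: k => k /=.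
    have [? ? ?] := simple_times hs (ltn_ord k).
    by split => //; exact: simple_entry hs _ _ _ _.
  have [t0 ? ?] := simple_times hs' (ltn_ord k); split => //.
  have [xF [c xc]] := simple_entry hs' i j (ltn_ord k).
  split; last by exists c => w /=; rewrite normrN.
  have sF : sigma_algebra setT (F (tau' k)) by case: hF => + _ _; apply.
  have z : fmeas (F (tau' k)) (fun _ : Om => 0 : R).
    by apply: (proj2 (fmeasP _ sF)); exact: measurable_cst.
  have := fmeasB sF z xF; rewrite (_ : (fun w => 0 - xi' k w i j) = x i j (inr k))//.
  by apply/funext => w; rewrite sub0r.
have /choice[Mh MhP] : forall ij : 'I_d * 'I_d, exists Mh : R * (Om -> R),
  [/\ has_integral P setT
        (fun w => (\sum_k x ij.1 ij.2 k w *
          (W (b k) w ij.2 ord0 - W (a k) w ij.2 ord0)) ^+ 2) (gvar * Mh.1),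
      forall w, has_integral leb `[0, t]
        (fun s => (\sum_k (\1_(`]a k, b k] : set R) s : R) * x ij.1 ij.2 k w) ^+ 2) (Mh.2 w) &
      has_integral P setT Mh.2 Mh.1].
  move=> [i j] /=.
  have [M [h Mh]] := elementary_isometry hF (brownian_coord j hW) (hab i j).
  by exists (M, h).
have siE w i : (simple_integral W n tau xi w - simple_integral W n' tau' xi' w) i ord0 =
    \sum_j \sum_k x i j k w * (W (b k) w j ord0 - W (a k) w j ord0).
  rewrite !mxE !summxE exchange_big /= big_sumType /= -sumrN; congr (_ + _).
    apply: eq_bigr => k _; rewrite !mxE; apply: eq_bigr => j _.
    by rewrite !mxE.
  apply: eq_bigr => k _; rewrite !mxE -sumrN; apply: eq_bigr => j _.
  by rewrite !mxE mulNr.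
have spE s w i j : (simple_process n tau xi s w - simple_process n' tau' xi' s w) i j =
    \sum_k (\1_(`]a k, b k] : set R) s : R) * x i j k w.
  rewrite !mxE !summxE big_sumType /= -sumrN; congr (_ + _).
    by apply: eq_bigr => k _; rewrite !mxE.
  by apply: eq_bigr => k _; rewrite !mxE mulrN.
pose M := \sum_i \sum_j (Mh (i, j)).1.
have -> : slab_integral P t (fun s w =>
     (frob (simple_process n tau xi s w - simple_process n' tau' xi' s w) ^+ 2)%:E) = M%:E.
  have H : has_integral P setT (fun w => \sum_i \sum_j (Mh (i, j)).2 w) M.
    apply: has_integral_sum => // i; apply: has_integral_sum => // j.
    by have [_ _] := MhP (i, j).
  rewrite -(proj2 H); apply: eq_integral => w _.
  have [_ <-] : has_integral leb `[0, t] (fun s => \sum_i \sum_j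
     (\sum_k (\1_(`]a k, b k] : set R) s : R) * x i j k w) ^+ 2)
     (\sum_i \sum_j (Mh (i, j)).2 w).
    apply: has_integral_sum => // i; apply: has_integral_sum => // j.
    by have [_ + _] := MhP (i, j); apply.
  apply: eq_integral => s _; rewrite frob_sq; congr EFin.
  by apply: eq_bigr => i _; apply: eq_bigr => j _; rewrite spE.
have [_ HE] : has_integral P setT (fun w => d%:R * \sum_i \sum_j
    (\sum_k x i j k w * (W (b k) w j ord0 - W (a k) w j ord0)) ^+ 2) (d%:R * (gvar * M)).
  apply: has_integralZ => //; rewrite /M mulr_sumr; apply: has_integral_sum => // i.
  rewrite mulr_sumr; apply: has_integral_sum => // j.
  by have [] := MhP (i, j).
rewrite -EFinM -mulrA -HE; apply: ge0_le_integral_nomeas => w _.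
  by rewrite lee_fin sqr_ge0.
rewrite lee_fin frob_sq mulr_sumr; apply: ler_sum => i _.
rewrite big_ord1 siE; apply: le_trans (sqr_sum_le _) _; by rewrite card_ord.
Qed.

Lemma mx_measurable_simple_integral (t : R) n tau xi : is_simple F t n tau xi ->
  mx_measurable setT (simple_integral W n tau xi).
Proof.
move=> hs i j; rewrite /simple_integral.
under eq_fun do rewrite summxE.
apply: measurable_sum => k; under eq_fun do rewrite mxE.
apply: measurable_sum => l; apply: measurable_funM.
  have [tk _ _] := simple_times hs (ltn_ord k).
  have [xF _] := simple_entry hs i l (ltn_ord k).
  by apply: (fmeas_measurable _ xF); case: hF => _ + _; apply.
have mW r : 0 <= r -> measurable_fun setT (fun w => W r w l j).
  move=> r0; case: hW => ad _ _ _ _.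
  have := ad r r0 l j; apply: fmeas_measurable; case: hF => _ + _; exact.
have [tk tk1 _] := simple_times hs (ltn_ord k).
under eq_fun do rewrite !mxE.
by apply: measurable_funB; apply: mW => //; exact: le_trans tk1.
Qed.

(** Meant for Ito integrals [A], [C] with simple approximations [B], [D]: the distance of the limits
    is controlled by that of the approximations. *)
Lemma mean_frob_triangle (m n : nat) (A B C D : Om -> 'M[R]_(m, n)) :
  mx_measurable setT A -> mx_measurable setT B ->
  mx_measurable setT C -> mx_measurable setT D ->
  (\int[P]_w (frob (A w - C w) ^+ 2)%:E <=
   3%:E * \int[P]_w (frob (A w - B w) ^+ 2)%:E +
   3%:E * \int[P]_w (frob (C w - D w) ^+ 2)%:E +
   3%:E * \int[P]_w (frob (B w - D w) ^+ 2)%:E)%E.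
Proof.
move=> mA mB mC mD.
have z3 : (0 <= 3%:E :> \bar R)%E by rewrite lee_fin.
pose g (U V : Om -> 'M[R]_(m, n)) w := (frob (U w - V w) ^+ 2)%:E.
have g0 U V w : (0 <= g U V w)%E by rewrite lee_fin sqr_ge0.
have mg U V : mx_measurable setT U -> mx_measurable setT V -> measurable_fun setT (g U V).
  by move=> mU mV; apply: mx_measurable_frob_sq; exact: mx_measurableB.
have m3g U V : mx_measurable setT U -> mx_measurable setT V ->
    measurable_fun setT (fun w => 3%:E * g U V w)%E.
  by move=> mU mV; apply: measurable_funeM; exact: mg.
have p3g U V w : (0 <= 3%:E * g U V w)%E by rewrite mule_ge0.
have Z U V : mx_measurable setT U -> mx_measurable setT V ->
    (\int[P]_w (3%:E * g U V w) = 3%:E * \int[P]_w g U V w)%E.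
  move=> mU mV; apply: ge0_integralZl => //; exact: mg.
have E12 := ge0_integralD P measurableT (fun w _ => p3g A B w) (m3g _ _ mA mB)
  (fun w _ => p3g C D w) (m3g _ _ mC mD).
have E123 := ge0_integralD P measurableT
  (fun w _ => adde_ge0 (p3g A B w) (p3g C D w))
  (emeasurable_funD (m3g _ _ mA mB) (m3g _ _ mC mD))
  (fun w _ => p3g B D w) (m3g _ _ mB mD).
have E : (\int[P]_w (3%:E * g A B w + 3%:E * g C D w + 3%:E * g B D w) =
   3%:E * \int[P]_w g A B w + 3%:E * \int[P]_w g C D w +
   3%:E * \int[P]_w g B D w)%E.
  apply: etrans E123 _; congr (_ + _)%E; last exact: Z.
  by apply: etrans E12 _; congr (_ + _)%E; exact: Z.
apply: le_trans (_ : _ <= \int[P]_w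
  (3%:E * g A B w + 3%:E * g C D w + 3%:E * g B D w))%E _; last by rewrite E.
apply: ge0_le_integral_nomeas => w _; first exact: g0.
rewrite -!EFinM -!EFinD lee_fin.
have -> : A w - C w = (A w - B w) + - (C w - D w) + (B w - D w).
  by apply/matrixP => i j; rewrite !mxE; ring.
by apply: le_trans (frob_sqD3 _ _ _) _; rewrite frobN.
Qed.

(** The opposite direction to [mean_frob_triangle], for the integrands: the distance of the simple
    processes [B], [D] is controlled by that of their limits [A], [C]. *)
Lemma slab_frob_triangle (t : R) (m n : nat) (A B C D : R -> Om -> 'M[R]_(m, n)) :
  mx_measurable (slab t) (fun p => A p.1 p.2) ->
  mx_measurable (slab t) (fun p => B p.1 p.2) ->
  mx_measurable (slab t) (fun p => C p.1 p.2) ->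
  mx_measurable (slab t) (fun p => D p.1 p.2) ->
  (slab_integral P t (fun s w => (frob (B s w - D s w) ^+ 2)%:E) <=
   3%:E * slab_integral P t (fun s w => (frob (A s w - B s w) ^+ 2)%:E) +
   3%:E * slab_integral P t (fun s w => (frob (C s w - D s w) ^+ 2)%:E) +
   3%:E * slab_integral P t (fun s w => (frob (A s w - C s w) ^+ 2)%:E))%E.
Proof.
move=> mA mB mC mD.
have z3 : (0 <= 3%:E :> \bar R)%E by rewrite lee_fin.
pose g (U V : R -> Om -> 'M[R]_(m, n)) s w := (frob (U s w - V s w) ^+ 2)%:E.
have mg U V : mx_measurable (slab t) (fun p => U p.1 p.2) ->
    mx_measurable (slab t) (fun p => V p.1 p.2) -> slab_nonneg t (g U V).
  by move=> mU mV; apply: slab_nonneg_frob; exact: mx_measurableB.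
have nAB := slab_nonnegZ z3 (mg _ _ mA mB).
have nCD := slab_nonnegZ z3 (mg _ _ mC mD).
have nAC := slab_nonnegZ z3 (mg _ _ mA mC).
have E : (slab_integral P t
     (fun s w => 3%:E * g A B s w + 3%:E * g C D s w + 3%:E * g A C s w) =
   3%:E * slab_integral P t (g A B) + 3%:E * slab_integral P t (g C D) +
   3%:E * slab_integral P t (g A C))%E.
  apply: etrans (slab_integralD P (slab_nonnegD nAB nCD) nAC) _.
  congr (_ + _)%E; last exact: (slab_integralZ P z3 (mg _ _ mA mC)).
  apply: etrans (slab_integralD P nAB nCD) _; congr (_ + _)%E.
    exact: (slab_integralZ P z3 (mg _ _ mA mB)).
  exact: (slab_integralZ P z3 (mg _ _ mC mD)).
apply: le_trans (_ : _ <= slab_integral P t (fun s w =>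
  3%:E * g A B s w + 3%:E * g C D s w + 3%:E * g A C s w))%E _; last by rewrite E.
apply: slab_integral_le => s w _; first by rewrite lee_fin sqr_ge0.
rewrite -!EFinM -!EFinD lee_fin.
have -> : B s w - D s w = - (A s w - B s w) + (C s w - D s w) + (A s w - C s w).
  by apply/matrixP => i j; rewrite !mxE; ring.
by apply: le_trans (frob_sqD3 _ _ _) _; rewrite frobN.
Qed.

(* The triangle inequality through the approximating simple integrals loses a
   numerical factor with respect to the isometry; only the order matters. *)
Lemma ito_diff_estimate (t : R) (H H' : R -> Om -> 'M[R]_d) (I I' : Om -> 'cV[R]_d) :
  is_ito_integral P F W t H I -> is_ito_integral P F W t H' I' ->
  (\int[P]_w (frob (I w - I' w) ^+ 2)%:E <=
   (9 * (d%:R * gvar))%:E * slab_integral P t (fun s w => (frob (H s w - H' s w) ^+ 2)%:E))%E.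
Proof.
move=> [mH _ mI [n [tau [xi [hs eH eI]]]]] [mH' _ mI' [n' [tau' [xi' [hs' eH' eI']]]]].
set Q := slab_integral _ _ _.
set c := d%:R * gvar.
have c0 : 0 <= c by rewrite mulr_ge0 ?gvar_ge0.
pose e m := slab_integral P t (fun s w =>
  (frob (H s w - simple_process (n m) (tau m) (xi m) s w) ^+ 2)%:E).
pose e' m := slab_integral P t (fun s w =>
  (frob (H' s w - simple_process (n' m) (tau' m) (xi' m) s w) ^+ 2)%:E).
pose f m := (\int[P]_w
  (frob (I w - simple_integral W (n m) (tau m) (xi m) w) ^+ 2)%:E)%E.
pose f' m := (\int[P]_w
  (frob (I' w - simple_integral W (n' m) (tau' m) (xi' m) w) ^+ 2)%:E)%E.
have {}eH : e @ \oo --> 0%E := eH.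
have {}eH' : e' @ \oo --> 0%E := eH'.
have {}eI : f @ \oo --> 0%E.
  rewrite (_ : f = (fun m => 'E_P[fun w => (frob (I w -
    simple_integral W (n m) (tau m) (xi m) w) ^+ 2)%R])%E)//.
  by apply/funext => m; rewrite unlock.
have {}eI' : f' @ \oo --> 0%E.
  rewrite (_ : f' = (fun m => 'E_P[fun w => (frob (I' w -
    simple_integral W (n' m) (tau' m) (xi' m) w) ^+ 2)%R])%E)//.
  by apply/funext => m; rewrite unlock.
(* One triangle inequality on each side of the simple isometry, each costing a factor 3, hence the
   9; in the limit only the term in [Q] survives. *)
pose u m := (3%:E * f m + 3%:E * f' m + (3 * c)%:E * (3%:E * e m + 3%:E * e' m + 3%:E * Q))%E.
have cZ (g : nat -> \bar R) : g @ \oo --> 0%E -> (3%:E * g m)%E @[m --> \oo] --> 0%E.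
  by move=> gl; rewrite -[X in _ --> X](mule0 3%:E); apply: cvgeZl; last exact: gl.
have cD (g g' : nat -> \bar R) : g @ \oo --> 0%E -> g' @ \oo --> 0%E ->
    (3%:E * g m + 3%:E * g' m)%E @[m --> \oo] --> 0%E.
  move=> gl gl'; rewrite -[X in _ --> X]adde0.
  by apply: cvgeD; [rewrite fin_num_adde_defr|exact: cZ gl|exact: cZ gl'].
have : u m @[m --> \oo] --> (0 + (3 * c)%:E * (0 + 3%:E * Q))%E.
  apply: cvgeD; [by rewrite fin_num_adde_defr|exact: cD eI eI'|].
  apply: cvgeZl; first by [].
  by apply: cvgeD; [rewrite fin_num_adde_defr|exact: cD eH eH'|exact: cvg_cst].
rewrite !add0e muleA -EFinM (_ : 3 * c * 3 = 9 * c); last by ring.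
move=> ulim; apply: (cvge_to_ge ulim); apply: nearW => m; rewrite /u.
pose S := simple_process (n m) (tau m) (xi m).
pose S' := simple_process (n' m) (tau' m) (xi' m).
pose J := simple_integral W (n m) (tau m) (xi m).
pose J' := simple_integral W (n' m) (tau' m) (xi' m).
have mJ : mx_measurable setT J by exact: mx_measurable_simple_integral (hs m).
have mJ' : mx_measurable setT J' by exact: mx_measurable_simple_integral (hs' m).
have mS := mx_measurable_simple_process (hs m).
have mS' := mx_measurable_simple_process (hs' m).
have nHS : slab_nonneg t (fun s w => (frob (H s w - S s w) ^+ 2)%:E).
  by apply: slab_nonneg_frob; exact: mx_measurableB.
have nHS' : slab_nonneg t (fun s w => (frob (H' s w - S' s w) ^+ 2)%:E).
  by apply: slab_nonneg_frob; exact: mx_measurableB.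
have nHH : slab_nonneg t (fun s w => (frob (H s w - H' s w) ^+ 2)%:E).
  by apply: slab_nonneg_frob; exact: mx_measurableB.
have eSS : (slab_integral P t (fun s w => (frob (S s w - S' s w) ^+ 2)%:E) <=
    3%:E * e m + 3%:E * e' m + 3%:E * Q)%E.
  exact: (slab_frob_triangle mH mS mH' mS').
have := simple_diff_isometry (hs m) (hs' m).
rewrite -/J -/J' -/S -/S' -/c => iso.
apply: (@le_trans _ _ (3%:E * f m + 3%:E * f' m +
   3%:E * \int[P]_w (frob (J w - J' w) ^+ 2)%:E)%E); last first.
  rewrite leeD2l// EFinM -muleA lee_wpmul2l ?lee_fin//.
  by apply: le_trans iso _; rewrite lee_wpmul2l ?lee_fin.
exact: mean_frob_triangle.
Qed.

End Ito.

(** * Gronwall inequality for Volterra kernels *)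

Section Convolution.
Context {R : realType}.
Local Notation leb := (@lebesgue_measure R).
Local Open Scope ereal_scope.

Lemma lebesgue_measure_reflect (t : R) (A : set (measurableTypeR R)) : measurable A ->
  pushforward leb (fun s : measurableTypeR R => (t - s)%R : measurableTypeR R) A = leb A.
Proof.
have mr : measurable_fun setT (fun s : measurableTypeR R => (t - s)%R : measurableTypeR R).
  exact: measurable_funB.
pose r : {mfun measurableTypeR R >-> measurableTypeR R} := HB.pack
  (fun s : measurableTypeR R => (t - s)%R : measurableTypeR R)
  (isMeasurableFun.Build _ _ _ _ _ mr).
move=> mA; apply/esym.
apply: (lebesgue_measure_unique (mu := pushforward leb r)) => //= _ [[a b]] _ <-.
(* Reflection exchanges open and closed endpoints but keeps the length, and lengths of such
   intervals determine Lebesgue measure. *)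
rewrite /pushforward (_ : _ @^-1` _ = `[(t - b)%R, (t - a)%R[%classic); last first.
  apply/seteqP; split=> s /=; rewrite !in_itv /=.
    by move=> /andP[h1 h2]; apply/andP; split; lra.
  by move=> /andP[h1 h2]; apply/andP; split; lra.
rewrite !lebesgue_measure_itv/= !lte_fin ltrD2l ltrN2.
by case: ifP => // _; rewrite -!EFinB; congr EFin; lra.
Qed.

Lemma ge0_integral_reflect (t : R) (f : R -> \bar R) :
  measurable_fun setT f -> (forall s, 0 <= f s) ->
  \int[leb]_s f (t - s)%R = \int[leb]_s f s.
Proof.
move=> mf f0.
have mr : measurable_fun setT (fun s : measurableTypeR R => (t - s)%R : measurableTypeR R).
  exact: measurable_funB.
have f0' : {in [set: measurableTypeR R], forall u, 0 <= f u} by move=> u _.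
apply: etrans (esym (ge0_integral_pushforward mr leb measurableT mf f0')) _.
by apply: eq_measure_integral => A mA _; exact: lebesgue_measure_reflect.
Qed.

(** A translation is the composite of two reflections. *)
Lemma ge0_integral_translate (s : R) (f : R -> \bar R) :
  measurable_fun setT f -> (forall s, 0 <= f s) ->
  \int[leb]_t f (t - s)%R = \int[leb]_t f t.
Proof.
move=> mf f0; transitivity (\int[leb]_u f (0 - u)%R); last exact: ge0_integral_reflect.
rewrite -(ge0_integral_reflect s (f := fun u => f (0 - u)%R))//; last first.
  by apply: measurableT_comp => //; exact: measurable_funB.
by apply: eq_integral => t _; congr f; lra.
Qed.

Lemma ge0_integral_convolution (k g : R -> \bar R) :
  measurable_fun setT k -> measurable_fun setT g ->
  (forall u, 0 <= k u) -> (forall u, 0 <= g u) ->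
  \int[leb]_t \int[leb]_s (k (t - s)%R * g s) = (\int[leb]_u k u) * \int[leb]_s g s.
Proof.
move=> mk mg k0 g0.
have mkg : measurable_fun setT
    (fun p : measurableTypeR R * measurableTypeR R => k (p.1 - p.2)%R * g p.2).
  apply: emeasurable_funM; last exact: (measurableT_comp mg measurable_snd).
  apply: (measurableT_comp mk); apply: measurable_funB.
    exact: measurable_fst.
  exact: measurable_snd.
rewrite (fubini_tonelli (fun p : measurableTypeR R * measurableTypeR R =>
  k (p.1 - p.2)%R * g p.2))//; last first.
  by move=> p; rewrite mule_ge0.
rewrite -ge0_integralZl//; last by apply: integral_ge0.
apply: eq_integral => s _ /=; rewrite ge0_integralZr//.
- by rewrite ge0_integral_translate.
- by apply: (measurableT_comp mk); apply: measurable_funB.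
Qed.

(** Dominated convergence along integer damping rates: the damped kernel tends to 0 wherever [u > 0]
    and [k u] is finite, and the point 0 is null. Vanishing of [k] on negative arguments makes [k]
    itself a dominating function. *)
Lemma damped_integral_small (k : R -> \bar R) (eps : R) :
  measurable_fun setT k -> (forall u, 0 <= k u) -> (forall u, (u < 0)%R -> k u = 0) ->
  \int[leb]_u k u < +oo -> (0 < eps)%R ->
  exists2 beta : R, (0 <= beta)%R & \int[leb]_u ((expR (- (beta * u)))%:E * k u) <= eps%:E.
Proof.
move=> mk k0 kneg ki eps0.
have ik : leb.-integrable setT k by exact: integrable_ge0_ltey.
pose f_ n (u : R) := (expR (- (n%:R * u)))%:E * k u.
have mf_ n : measurable_fun setT (f_ n).
  apply: emeasurable_funM => //; apply/measurable_EFinP.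
  have m1 : measurable_fun setT (fun u : R => (- (n%:R * u))%R).
    exact: (measurableT_comp (@oppr_measurable R setT) (@mulrl_measurable R setT n%:R)).
  exact: (measurableT_comp (@measurable_expR R) m1).
have dom n u : `|f_ n u| <= k u.
  rewrite gee0_abs; last by rewrite mule_ge0 ?lee_fin ?expR_ge0.
  have [u0|u0] := ltP u 0%R; first by rewrite /f_ kneg// mule0.
  rewrite -[leRHS]mul1e; apply: lee_wpmul2r => //.
  by rewrite lee_fin -expR0 ler_expR oppr_le0 mulr_ge0.
have lim0 : {ae leb, forall u, setT u -> f_ ^~ u @ \oo --> (cst 0 u : \bar R)}.
  have ae0 : {ae leb, forall u : measurableTypeR R, u != 0%R}.
    exists [set 0%R]; split; [exact: measurable_set1|exact: lebesgue_measure_set1|].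
    by move=> u /= /negP; rewrite negbK => /eqP.
  have aek := integrable_ae measurableT ik.
  apply: filterS2 ae0 aek => u u0 /(_ I) kfin _.
  have [un|up] := ltP u 0%R.
    rewrite (_ : f_ ^~ u = cst 0); first exact: cvg_cst.
    by apply/funext => n; rewrite /f_ kneg// mule0.
  have {u0}up : (0 < u)%R by rewrite lt_def u0.
  rewrite /f_ -(fineK kfin).
  rewrite (_ : (fun _ => _) = EFin \o (fun n => fine (k u) * expR (- u) ^+ n)%R); last first.
    by apply/funext => n /=; rewrite -EFinM mulrC -expRM_natl mulrN.
  apply: cvg_EFin; first exact: nearW.
  rewrite -[X in _ --> X](mulr0 (fine (k u))).
  apply: cvgMr; apply: cvg_expr.
  by rewrite ger0_norm ?expR_ge0// -expR0 ltr_expR oppr_lt0.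
have dom' : {ae leb, forall (u : measurableTypeR R) (n : nat), setT u -> `|f_ n u| <= k u}.
  by apply: aeW => u n _; exact: dom.
have [_ _] := @dominated_convergence _ _ _ leb setT measurableT f_ (cst 0) k mf_
  (measurable_cst _) lim0 ik dom'.
rewrite integral0 => cv.
have [[n fn]|nex] := pselect (exists n : nat, \int[leb]_u f_ n u <= eps%:E).
  by exists n%:R.
suff : eps%:E <= 0 :> \bar R by rewrite lee_fin leNgt eps0.
apply: (cvge_to_ge cv); apply: nearW => n; apply/ltW; rewrite ltNge.
by apply/negP => fn; apply: nex; exists n.
Qed.

(* The excess g of the damped function over 2A satisfies g <= kappa * g with
   kappa of mass at most 1/2, so its integral vanishes; it is then zero
   everywhere because kappa * g is. *)
Lemma volterra_gronwall (k : R -> \bar R) (T B : R) :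
  measurable_fun setT k -> (forall u, 0 <= k u) -> (forall u, (u < 0)%R -> k u = 0) ->
  \int[leb]_u k u < +oo -> (0 <= B)%R ->
  exists2 C : R, (0 < C)%R &
  forall (A : R) (phi : R -> \bar R), (0 <= A)%R ->
    measurable_fun setT phi -> (forall t, 0 <= phi t) ->
    (forall t, (t < 0)%R -> phi t = 0) -> (forall t, (T < t)%R -> phi t = 0) ->
    \int[leb]_t phi t < +oo ->
    (forall t, (0 <= t <= T)%R ->
      phi t <= A%:E + B%:E * \int[leb]_s (k (t - s)%R * phi s)) ->
    forall t, (0 <= t <= T)%R -> phi t <= (C * A)%:E.
Proof.
move=> mk k0 kneg ki B0.
(* Chosen so that [B] times the damped mass is at most 1/2; [B + 1] in place of [B] allows
   [B = 0]. *)
have eps0 : (0 < (2 * (B + 1))^-1)%R by rewrite invr_gt0 mulr_gt0// ltr_wpDl.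
have [beta beta0 hbeta] := damped_integral_small mk k0 kneg ki eps0.
pose ex (u : R) := expR (- (beta * u)).
pose kap u := (ex u)%:E * k u.
have mex : measurable_fun setT (fun u => (ex u)%:E).
  apply/measurable_EFinP.
  have m1 : measurable_fun setT (fun u : R => (- (beta * u))%R).
    exact: (measurableT_comp (@oppr_measurable R setT) (@mulrl_measurable R setT beta)).
  exact: (measurableT_comp (@measurable_expR R) m1).
have ex0 u : 0 <= (ex u)%:E by rewrite lee_fin expR_ge0.
have mkap : measurable_fun setT kap by exact: emeasurable_funM.
have kap0 u : 0 <= kap u by rewrite mule_ge0.
have Bkap : B%:E * \int[leb]_u kap u <= (2^-1)%:E.
  apply: (@le_trans _ _ (B%:E * ((2 * (B + 1))^-1)%:E)); first by rewrite lee_wpmul2l ?lee_fin.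
  by rewrite -EFinM lee_fin invfM mulrCA ler_piMr// ler_pdivrMr ?mul1r ?lerDl// ltr_wpDl.
(* The 2 is the threshold in [2 * A] below, and the exponential undoes the damping on [[0, T]]. *)
exists (2 * expR (beta * T))%R; first by rewrite mulr_gt0 ?expR_gt0.
move=> A phi A0 mphi phi0 phin phip phii hphi.
pose psi t := (ex t)%:E * phi t.
pose g t := maxe (psi t - (2 * A)%:E) 0.
have mpsi : measurable_fun setT psi by exact: emeasurable_funM.
have psi0 t : 0 <= psi t by rewrite mule_ge0.
have mg : measurable_fun setT g.
  apply: measurable_maxe => //; exact: emeasurable_funB.
have g0 t : 0 <= g t by rewrite le_max lexx orbT.
have psig t : psi t <= (2 * A)%:E + g t.
  by rewrite -leeBlDl// le_max lexx.
have A20 : 0 <= (2 * A)%:E by rewrite lee_fin mulr_ge0.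
have gneg t : ~~ (0 <= t <= T)%R -> g t = 0.
  move=> tT; have -> : g t = maxe (0 - (2 * A)%:E) 0.
    rewrite /g /psi; suff -> : phi t = 0 by rewrite mule0.
    move: tT; rewrite negb_and -!ltNge => /orP[]; [exact: phin|exact: phip].
  by rewrite sub0e max_r// leeNl oppe0.
pose cg t := \int[leb]_s (kap (t - s)%R * g s).
have gle t : g t <= B%:E * cg t.
  have cg0 : 0 <= B%:E * cg t.
    by rewrite mule_ge0 ?lee_fin ?integral_ge0// => s _; rewrite mule_ge0.
  have [tT|/gneg -> //] := boolP (0 <= t <= T)%R.
  rewrite /g ge_max cg0 andbT leeBlDl//.
  have ksm : measurable_fun setT (fun s : R => kap (t - s)%R).
    by apply: (measurableT_comp mkap); exact: measurable_funB.
  have H : psi t <= (ex t)%:E * (A%:E + B%:E * \int[leb]_s (k (t - s)%R * phi s)).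
    by apply: lee_wpmul2l => //; exact: hphi.
  apply: (le_trans H); rewrite ge0_muleDr ?lee_fin//; last first.
    by rewrite mule_ge0 ?lee_fin ?integral_ge0// => s _; rewrite mule_ge0.
  have H1 : (ex t)%:E * A%:E <= A%:E.
    rewrite -EFinM lee_fin ler_piMl// -expR0 ler_expR oppr_le0 mulr_ge0//.
    by case/andP: tT.
  have H2 : (ex t)%:E * \int[leb]_s (k (t - s)%R * phi s) <=
            (2 * A)%:E * (\int[leb]_u kap u) + cg t.
    rewrite -ge0_integralZl//; last 2 first.
    - apply: emeasurable_funM => //; apply: (measurableT_comp mk); exact: measurable_funB.
    - by move=> s _; rewrite mule_ge0.
    rewrite -(ge0_integral_reflect t mkap kap0) -ge0_integralZl//.
    rewrite -ge0_integralD//; last 4 first.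
    - by move=> s _; rewrite mule_ge0.
    - exact: measurable_funeM.
    - by move=> s _; rewrite mule_ge0.
    - exact: emeasurable_funM.
    apply: ge0_le_integral_nomeas => s _; first by rewrite !mule_ge0.
    rewrite [(2 * A)%:E * _]muleC -ge0_muleDr//.
    apply: le_trans (lee_wpmul2l _ (psig s)) => //.
    (* Multiplicativity of the exponential: damping a convolution amounts to damping both of its
       factors. *)
    have -> : ex t = (ex (t - s)%R * ex s)%R.
      by rewrite /ex -expRD; congr expR; ring.
    rewrite /kap /psi EFinM !muleA [X in X * phi s]muleAC.
    by rewrite lexx.
  apply: (@le_trans _ _ (A%:E + B%:E * ((2 * A)%:E * (\int[leb]_u kap u) + cg t))).
    by apply: leeD => //; rewrite muleCA; apply: lee_wpmul2l; rewrite ?lee_fin.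
  rewrite ge0_muleDr//; last 2 first.
  - by rewrite mule_ge0// integral_ge0.
  - by apply: integral_ge0 => s _; rewrite mule_ge0.
  rewrite addeA; apply: leeD => //; rewrite muleCA.
  (* The threshold reproduces itself: [A] from the source plus half of [2 * A] from the kernel is
     again [2 * A]. *)
  apply: (@le_trans _ _ (A%:E + (2 * A)%:E * (2^-1)%:E)).
    by apply: leeD => //; exact: lee_wpmul2l.
  by rewrite -EFinM -EFinD lee_fin; lra.
(* This makes the integral of [g] finite, without which an integral at most half of itself could
   still be infinite. *)
have gphi t : g t <= phi t.
  have [tT|/gneg -> //] := boolP (0 <= t <= T)%R.
  rewrite /g ge_max phi0 andbT leeBlDr//.
  apply: (@le_trans _ _ (phi t)); last by rewrite leeDl.
  rewrite -[leRHS]mul1e; apply: lee_wpmul2r => //; rewrite lee_fin -expR0 ler_expR.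
  by rewrite oppr_le0 mulr_ge0//; case/andP: tT.
have gi : \int[leb]_t g t < +oo.
  by apply: le_lt_trans phii; exact: ge0_le_integral_nomeas.
have gz : \int[leb]_t g t = 0.
  have gi0 : 0 <= \int[leb]_t g t by exact: integral_ge0.
  have mcg : measurable_fun setT cg.
    apply: (measurable_fun_fubini_tonelli_F
      (fun p : measurableTypeR R * measurableTypeR R => kap (p.1 - p.2)%R * g p.2)).
    - apply: emeasurable_funM; last exact: (measurableT_comp mg measurable_snd).
      apply: (measurableT_comp mkap); apply: measurable_funB.
        exact: measurable_fst.
      exact: measurable_snd.
    - by move=> p; rewrite mule_ge0.
  have H : \int[leb]_t g t <= (2^-1)%:E * \int[leb]_t g t.
    apply: (@le_trans _ _ (\int[leb]_t (B%:E * cg t))).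
      exact: ge0_le_integral_nomeas.
    rewrite ge0_integralZl//; last first.
      by move=> t _; apply: integral_ge0 => s _; rewrite mule_ge0.
    rewrite /cg ge0_integral_convolution// muleA.
    by apply: lee_wpmul2r.
  move: gi0 gi H; case: (\int[leb]_t g t) => [r| |]//; rewrite -EFinM !lee_fin => r0 _ rr.
  by congr EFin; lra.
have gae : ae_eq leb setT g (cst 0).
  apply: (proj1 (ae_eq_integral_abs leb measurableT mg)).
  by under eq_integral do rewrite gee0_abs//.
have cgz t : cg t = 0.
  rewrite /cg (ae_eq_integral (cst 0))//; first exact: integral0.
  - apply: emeasurable_funM => //; apply: (measurableT_comp mkap); exact: measurable_funB.
  - by apply: filterS gae => s /= h _; rewrite h// mule0.
move=> t tT.
have : psi t <= (2 * A)%:E.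
  apply: le_trans (psig t) _; have := gle t; rewrite cgz mule0 => gt0.
  by rewrite -[leRHS]adde0; apply: leeD.
have eE : phi t = (expR (beta * t))%:E * psi t.
  by rewrite /psi muleA -EFinM /ex -expRD addrN expR0 mul1e.
move=> psiA; rewrite eE; apply: (@le_trans _ _ ((expR (beta * t))%:E * (2 * A)%:E)).
  by apply: lee_wpmul2l => //; rewrite lee_fin expR_ge0.
rewrite -EFinM lee_fin mulrCA -mulrA ler_wpM2l// ler_wpM2r//.
by rewrite ler_expR ler_wpM2l//; case/andP: tT.
Qed.

End Convolution.

(** * Laplace kernels *)

Lemma measurable_expRNM (R : realType) (t : R) :
  measurable_fun setT (fun rho : R => expR (- rho * t)).
Proof.
apply: (measurableT_comp (@measurable_expR R)).
by apply: measurable_funM => //; exact: measurable_funN.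
Qed.


Section Kernels.
Context {R : realType}.
Variable lam : {measure set (measurableTypeR R) -> \bar R}.
Hypothesis hGbar : forall t : R, 0 < t -> (Gbar lam t < +oo)%E.
Local Notation leb := (@lebesgue_measure R).

Definition laplace (D : set (measurableTypeR R)) (t : R) : \bar R :=
  (\int[lam]_(rho in D) (expR (- rho * t))%:E)%E.

Lemma laplace_ge0 D t : (0 <= laplace D t)%E.
Proof. by apply: integral_ge0 => rho _; rewrite lee_fin expR_ge0. Qed.

Let mexp2 : measurable_fun setT
  (fun p : measurableTypeR R * measurableTypeR R => expR (- p.1 * p.2)).
Proof.
apply: (measurableT_comp (@measurable_expR R)).
apply: (measurable_funM (f := fun p : measurableTypeR R * measurableTypeR R => - p.1)
  (g := fun p : measurableTypeR R * measurableTypeR R => p.2)).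
  exact: (measurableT_comp (@oppr_measurable R setT) measurable_fst).
exact: measurable_snd.
Qed.

(** Since [1 <= e^(a - rho)] on [[0, a]], the value of [Gbar] at 1 controls the mass there. *)
Lemma measure_bounded_fin (a : R) : (lam `[0%R, a]%classic < +oo)%E.
Proof.
apply: (@le_lt_trans _ _ ((expR a)%:E * Gbar lam 1)%E); last first.
  have := hGbar ltr01; have : (0 <= Gbar lam 1)%E by exact: laplace_ge0.
  by case: (Gbar lam 1) => // r _ _; rewrite -EFinM ltry.
rewrite /Gbar -ge0_integralZl//; last first.
  by apply/measurable_EFinP; apply: measurable_funTS; exact: measurable_expRNM.
apply: (@le_trans _ _ (\int[lam]_(rho in `[0%R, a]) 1)%E).
  by rewrite integral_cst// mul1e.
apply: (@le_trans _ _ (\int[lam]_(rho in `[0%R, a]) ((expR a)%:E * (expR (- rho * 1))%:E))%E).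
  apply: ge0_le_integral_nomeas => rho //=; rewrite in_itv/= => /andP[_ ra].
  by rewrite mulr1 -EFinM lee_fin -expRD -expR0 ler_expR subr_ge0.
apply: ge0_subset_integral => //.
- apply/measurable_EFinP; apply: measurable_funTS; apply: measurable_funM => //.
  exact: measurable_expRNM.
- by move=> rho /=; rewrite !in_itv/= => /andP[->].
Qed.

(** Tonelli against [lam] requires sigma-finiteness, which here is a consequence of finiteness of
    [Gbar]. The measure is restricted to the half-line because [Gbar] says nothing about [lam] on
    the negative reals. *)
Lemma sigma_finite_halfline :
  exists mu : {sigma_finite_measure set (measurableTypeR R) -> \bar R},
  forall A, A `<=` `[0%R, +oo[ -> mu A = lam A.
Proof.
have m0 : measurable (`[0%R, +oo[%classic : set (measurableTypeR R)) by exact: measurable_itv.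
have sf : sigma_finite setT (mrestr lam m0).
  exists (fun n => `]-oo, n%:R]%classic).
    apply/seteqP; split=> // x _; exists (Num.truncn `|x|).+1 => //=.
    rewrite in_itv/= (le_trans (ler_norm x))// ltW//.
    by rewrite truncnS_gt.
  move=> n; split; first exact: measurable_itv.
  rewrite /mrestr (_ : _ `&` _ = `[0%R, n%:R]%classic) ?measure_bounded_fin//.
  apply/seteqP; split=> x /=; rewrite !in_itv/= ?andbT; first by move=> [-> ->].
  by move=> /andP[-> ->].
exists (HB.pack_for {sigma_finite_measure set (measurableTypeR R) -> \bar R}
  (mrestr lam m0) (Measure_isSigmaFinite.Build _ _ _ (mrestr lam m0) sf)).
by move=> A A0; rewrite /= /mrestr setIidl.
Qed.

Lemma measurable_laplace (D : set (measurableTypeR R)) : measurable D -> D `<=` `[0%R, +oo[ ->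
  measurable_fun setT (laplace D).
Proof.
move=> mD D0; have [mu muE] := sigma_finite_halfline.
pose h (p : measurableTypeR R * measurableTypeR R) :=
  ((expR (- p.1 * p.2) * \1_D p.1)%:E).
have mh : measurable_fun setT h.
  apply/measurable_EFinP; apply: measurable_funM.
    exact: mexp2.
  by apply: (measurableT_comp _ measurable_fst); apply: measurable_indic.
have -> : laplace D = fun t => (\int[mu]_rho h (rho, t))%E.
  apply/funext => t; rewrite /laplace.
  rewrite (eq_measure_integral mu); last first.
    by move=> A mA AD; rewrite -muE//; exact: subset_trans D0.
  rewrite integral_mkcond; apply: eq_integral => rho _.
  by rewrite /h patchE indicE; case: ifP => _; rewrite ?mulr1 ?mulr0.
apply: measurable_fun_fubini_tonelli_G => // p.
by rewrite lee_fin mulr_ge0 ?expR_ge0// indicE.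
Qed.

(** On [u >= 0] the integrand is [r^-1] times the exponential density of rate [r], whose total mass
    is 1. *)
Lemma integral_exp_le (r T : R) : 0 < r ->
  (\int[leb]_(u in `[0%R, T]) (expR (- r * u))%:E <= (r^-1)%:E)%E.
Proof.
move=> r0.
apply: (@le_trans _ _ ((r^-1)%:E * \int[leb]_u (exponential_pdf r u)%:E)%E); last first.
  by rewrite integral_exponential_pdf// mule1.
rewrite -ge0_integralZl//; last 3 first.
- by apply/measurable_EFinP; exact: measurable_exponential_pdf.
- by move=> u _; rewrite lee_fin exponential_pdf_ge0// ltW.
- by rewrite lee_fin invr_ge0 ltW.
rewrite [leLHS]integral_mkcond; apply: ge0_le_integral_nomeas => u _.
  by rewrite patchE; case: ifP => // _; rewrite lee_fin expR_ge0.
rewrite patchE; case: ifPn => [/set_mem|_]; last first.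
  by rewrite -EFinM lee_fin mulr_ge0 ?exponential_pdf_ge0 ?invr_ge0 ?ltW.
rewrite /= in_itv/= => /andP[u0 _]; rewrite exponential_pdfE//.
by rewrite -EFinM lee_fin mulrA mulVf ?gt_eqF// mul1r.
Qed.

Lemma integral_tail_sqr_le (K T : R) : 0 < K ->
  (\int[leb]_(u in `[0%R, T]) (laplace `[K, +oo[ u * laplace `[K, +oo[ u) <=
   tail_energy lam K)%E.
Proof.
move=> K0; have [mu muE] := sigma_finite_halfline.
have D0 : `[K, +oo[%classic `<=` (`[0%R, +oo[%classic : set R).
  by move=> x /=; rewrite !in_itv/= !andbT; apply: le_trans; exact: ltW.
pose I (x : R) : R := \1_(`[K, +oo[%classic : set (measurableTypeR R)) x.
have mI : measurable_fun setT I by apply: measurable_indic.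
have I0 x : 0 <= I x by rewrite /I indicE.
pose J (x : R) : R := \1_(`[0%R, T]%classic : set (measurableTypeR R)) x.
have mJ : measurable_fun setT J by apply: measurable_indic.
have J0 x : 0 <= J x by rewrite /J indicE.
have toI (f : R -> \bar R) :
    (\int[lam]_(x in `[K, +oo[) f x = \int[mu]_x ((I x)%:E * f x))%E.
  rewrite (eq_measure_integral mu); last first.
    by move=> A mA AD; rewrite -muE//; exact: subset_trans D0.
  rewrite [LHS]integral_mkcond; apply: eq_integral => x _.
  by rewrite /I patchE indicE; case: ifP => _; rewrite ?mul1e ?mul0e.
pose E (x u : R) := expR (- x * u).
have E0 x u : 0 <= E x u by exact: expR_ge0.
have mE : measurable_fun setT (fun p : measurableTypeR R * measurableTypeR R => E p.1 p.2).
  exact: mexp2.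
have msw : measurable_fun setT
    (fun p : measurableTypeR R * measurableTypeR R => (p.2, p.1)).
  exact: (measurable_fun_pair measurable_snd measurable_fst).
pose A u := laplace `[K, +oo[ u.
have A0 u : (0 <= A u)%E by exact: laplace_ge0.
have mA : measurable_fun setT A by exact: measurable_laplace.
have AE u : A u = (\int[mu]_x ((I x)%:E * (E x u)%:E))%E.
  by rewrite /A /laplace toI.
(* Only one factor of the square is expanded and the other stays as [A], so that each of the two
   exchanges of integrals involves just two measures; [h2] below expands the second factor. *)
pose h1 (p : measurableTypeR R * measurableTypeR R) :=
  ((J p.1)%:E * ((I p.2)%:E * (E p.2 p.1)%:E) * A p.1)%E.
have h10 p : (0 <= h1 p)%E by rewrite !mule_ge0// lee_fin.
have mh1 : measurable_fun setT h1.
  apply: emeasurable_funM; last exact: (measurableT_comp mA measurable_fst).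
  apply: emeasurable_funM.
    by apply/measurable_EFinP; exact: (measurableT_comp mJ measurable_fst).
  apply: emeasurable_funM.
    by apply/measurable_EFinP; exact: (measurableT_comp mI measurable_snd).
  apply/measurable_EFinP; exact: (measurableT_comp mE msw).
have step1 : (\int[leb]_(u in `[0%R, T]) (A u * A u) = \int[leb]_u \int[mu]_x h1 (u, x))%E.
  rewrite [LHS]integral_mkcond; apply: eq_integral => u _; rewrite /h1 /=.
  rewrite ge0_integralZr//; last 2 first.
  - do 2 (apply: emeasurable_funM => //); first by apply/measurable_EFinP.
    by apply/measurable_EFinP; exact: measurable_expRNM.
  - by move=> x _; rewrite !mule_ge0// lee_fin.
  rewrite ge0_integralZl//; last 3 first.
  - apply: emeasurable_funM => //; first by apply/measurable_EFinP.
    by apply/measurable_EFinP; exact: measurable_expRNM.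
  - by move=> x _; rewrite !mule_ge0// lee_fin.
  - by rewrite lee_fin.
  by rewrite -AE patchE /J indicE; case: ifP => _; rewrite ?mul1e ?mul0e.
rewrite step1 fubini_tonelli// /tail_energy toI.
apply: ge0_le_integral_nomeas => x _; first by apply: integral_ge0 => u _; exact: h10.
have [xK|xK] := boolP (x \in (`[K, +oo[%classic : set (measurableTypeR R))); last first.
  have Ix : I x = 0 by rewrite /I indicE (negbTE xK).
  rewrite Ix mul0e integral0_eq// => u _.
  by rewrite /h1 /= Ix mul0e mule0 mul0e.
have Ix : I x = 1 by rewrite /I indicE xK.
have x0 : 0 < x by move: xK => /set_mem /=; rewrite in_itv/= andbT; exact: lt_le_trans.
rewrite Ix mul1e toI.
pose h2 (p : measurableTypeR R * measurableTypeR R) : \bar R :=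
  (J p.1 * E x p.1 * (I p.2 * E p.2 p.1))%:E.
have h20 p : (0 <= h2 p)%E by rewrite lee_fin !mulr_ge0.
have mEx : measurable_fun setT (E x).
  apply: (measurableT_comp (@measurable_expR R)).
  exact: (@mulrl_measurable R setT (- x)).
have mh2 : measurable_fun setT h2.
  apply/measurable_EFinP; apply: measurable_funM.
    apply: measurable_funM; first exact: (measurableT_comp mJ measurable_fst).
    exact: (measurableT_comp mEx measurable_fst).
  apply: measurable_funM; first exact: (measurableT_comp mI measurable_snd).
  exact: (measurableT_comp mE msw).
have -> : (\int[leb]_u h1 (u, x) = \int[leb]_u \int[mu]_y h2 (u, y))%E.
  apply: eq_integral => u _; rewrite /h1 /h2 /= Ix mul1e AE -ge0_integralZl//.
  - apply: emeasurable_funM; first by apply/measurable_EFinP.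
    by apply/measurable_EFinP; exact: measurable_expRNM.
  - by move=> y _; rewrite mule_ge0// lee_fin.
  - by rewrite mule_ge0// lee_fin.
rewrite fubini_tonelli//.
apply: ge0_le_integral_nomeas => y _; first by apply: integral_ge0 => u _; exact: h20.
have [yK|yK] := boolP (y \in (`[K, +oo[%classic : set (measurableTypeR R))); last first.
  have Iy : I y = 0 by rewrite /I indicE (negbTE yK).
  rewrite Iy mul0e integral0_eq// => u _.
  by rewrite /h2 /= Iy mul0r mulr0.
have Iy : I y = 1 by rewrite /I indicE yK.
have y0 : 0 < y by move: yK => /set_mem /=; rewrite in_itv/= andbT; exact: lt_le_trans.
(* The two exponentials combine into one of rate [x + y], positive because [K] is; this is where the
   weight of [tail_energy] appears. *)
rewrite Iy mul1e; apply: le_trans (integral_exp_le T (addr_gt0 x0 y0)).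
rewrite [leRHS]integral_mkcond; apply: ge0_le_integral_nomeas => u _; first exact: h20.
rewrite /h2 /= Iy mul1r patchE /J indicE; case: ifP => _; last by rewrite !mul0r.
by rewrite mul1r lee_fin /E -expRD mulNr mulNr -opprD -mulrDl mulNr.
Qed.

End Kernels.

(** * Frobenius bounds for the matrix kernels *)

Lemma frob_sq_le_entries (R : realType) (m n : nat) (A : 'M[R]_(m, n)) (r : \bar R) :
  (forall i j, (`|A i j|%:E <= r)%E) ->
  ((frob A ^+ 2)%:E <= (m * n)%:R%:E * (r * r))%E.
Proof.
move=> Ar; rewrite frob_sq -sumEFin.
apply: (@le_trans _ _ (\sum_(i < m) \sum_(j < n) (r * r))%E).
  apply: lee_sum => i _; rewrite -sumEFin; apply: lee_sum => j _.
  rewrite -[A i j ^+ 2]real_normK ?num_real// expr2 EFinM.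
  by apply: lee_pmul; rewrite ?lee_fin.
by rewrite !sumr_const !card_ord -mulrnA mule_natl mulnC.
Qed.

Section MatrixKernels.
Context {R : realType}.
Variable lam : {measure set (measurableTypeR R) -> \bar R}.
Hypothesis hGbar : forall t : R, 0 < t -> (Gbar lam t < +oo)%E.
Variables (d : nat) (M : R -> 'M[R]_d) (c : R).
Hypotheses (c0 : 0 < c) (mM : mx_measurable (`[0, +oo[ : set (measurableTypeR R)) M).
Hypothesis Mc : forall rho, 0 <= rho -> frob (M rho) <= c.

Let E (t : R) i j (rho : R) := expR (- rho * t) * M rho i j.

Section Domain.
Variable D : set (measurableTypeR R).
Hypotheses (mD : measurable D) (D0 : D `<=` `[0, +oo[).

Lemma measurable_laplace_integrand t i j : measurable_fun D (fun rho => (E t i j rho)%:E).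
Proof.
apply/measurable_EFinP; apply: measurable_funM.
  by apply: measurable_funTS; exact: measurable_expRNM.
by apply: measurable_funS (mM i j) => //; exact: measurable_itv.
Qed.

Let absE t i j : (\int[lam]_(rho in D) `|(E t i j rho)%:E| <= c%:E * laplace lam D t)%E.
Proof.
rewrite /laplace -ge0_integralZl//; last 2 first.
- by apply/measurable_EFinP; apply: measurable_funTS; exact: measurable_expRNM.
- by rewrite lee_fin ltW.
apply: ge0_le_integral_nomeas => rho Drho; first exact: abse_ge0.
have rho0 : 0 <= rho by have := D0 Drho; rewrite /= in_itv/= andbT.
rewrite -EFinM lee_fin /E normrM ger0_norm ?expR_ge0// mulrC ler_wpM2r ?expR_ge0//.
by apply: le_trans (frob_entry _ _ _) _; exact: Mc.
Qed.

Lemma abs_laplace_on_entry t i j :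
  (`|laplace_on lam D M t i j|%:E <= c%:E * laplace lam D t)%E.
Proof.
apply: le_trans (absE t i j); rewrite /laplace_on mxE /Rintegral.
apply: le_trans (le_abse_integral lam mD (measurable_laplace_integrand t i j)).
(* For an infinite integral the entry takes the default value 0 of [fine], and the bound still
   holds. *)
by case: (integral _ _ _) => [r| |]//=; rewrite normr0 leey.
Qed.

Lemma integrable_laplace_on t i j : (laplace lam D t < +oo)%E ->
  lam.-integrable D (fun rho => (E t i j rho)%:E).
Proof.
move=> fin; apply/integrableP; split; first exact: measurable_laplace_integrand.
apply: le_lt_trans (absE t i j) _.
have := laplace_ge0 lam D t; case: (laplace _ _ _) fin => // r _ _.
by rewrite -EFinM ltry.
Qed.

Lemma frob_laplace_on t : ((frob (laplace_on lam D M t) ^+ 2)%:E <=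
  (d ^ 2)%:R%:E * ((c * c)%:E * (laplace lam D t * laplace lam D t)))%E.
Proof.
apply: le_trans (frob_sq_le_entries (abs_laplace_on_entry t)) _.
by rewrite mulnn EFinM muleACA.
Qed.

End Domain.

Lemma laplace_subset (A B : set (measurableTypeR R)) t : measurable A -> measurable B ->
  A `<=` B -> (laplace lam A t <= laplace lam B t)%E.
Proof.
move=> mA mB AB; apply: ge0_subset_integral => //.
by apply: measurable_funTS; apply/measurable_EFinP; exact: measurable_expRNM.
Qed.

(** The exponential is at most 1 on a domain of finite mass, so [t = 0] is allowed here, unlike for
    [Gbar]. *)
Lemma laplace_fin (K t : R) : 0 <= t -> (laplace lam `[0%R, K[%classic t < +oo)%E.
Proof.
move=> t0; apply: le_lt_trans (measure_bounded_fin hGbar K).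
rewrite -[leRHS]mul1e -integral_cst//.
apply: (@le_trans _ _ (\int[lam]_(rho in `[0%R, K]) (expR (- rho * t))%:E)%E).
  apply: laplace_subset; [exact: measurable_itv|exact: measurable_itv|].
  by move=> x /=; rewrite !in_itv/= => /andP[-> /ltW ->].
apply: ge0_le_integral_nomeas => rho; first by rewrite lee_fin expR_ge0.
rewrite /= in_itv/= => /andP[r0 _].
by rewrite lee_fin -expR0 ler_expR mulNr oppr_le0 mulr_ge0.
Qed.

Lemma frob_full_kernel t : ((frob (full_kernel lam M t) ^+ 2)%:E <=
  (d ^ 2)%:R%:E * ((c * c)%:E * (Gbar lam t * Gbar lam t)))%E.
Proof. by apply: frob_laplace_on => //; exact: measurable_itv. Qed.

(** The bound is free of [K], which is what makes the Gronwall constant uniform in the truncation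
    level. *)
Lemma frob_trunc_kernel K t : ((frob (trunc_kernel lam K M t) ^+ 2)%:E <=
  (d ^ 2)%:R%:E * ((c * c)%:E * (Gbar lam t * Gbar lam t)))%E.
Proof.
have m1 : measurable (`[0%R, K[%classic : set (measurableTypeR R)) by exact: measurable_itv.
have m2 : measurable (`[0%R, +oo[%classic : set (measurableTypeR R)) by exact: measurable_itv.
have s : `[0%R, K[%classic `<=` (`[0%R, +oo[%classic : set R).
  by move=> x /=; rewrite !in_itv/= => /andP[->].
apply: le_trans (frob_laplace_on m1 s t) _.
apply: lee_wpmul2l; first by rewrite lee_fin.
apply: lee_wpmul2l; first by rewrite lee_fin mulr_ge0 ?ltW.
by apply: lee_pmul; rewrite ?laplace_ge0//; exact: laplace_subset.
Qed.

Lemma frob_kernel_diff K t : 0 < K -> 0 <= t ->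
  ((frob (full_kernel lam M t - trunc_kernel lam K M t) ^+ 2)%:E <=
  (d ^ 2)%:R%:E * ((c * c)%:E *
    (laplace lam `[K, +oo[%classic t * laplace lam `[K, +oo[%classic t)))%E.
Proof.
move=> K0 t0.
have m1 : measurable (`[0%R, K[%classic : set (measurableTypeR R)) by exact: measurable_itv.
have m2 : measurable (`[K, +oo[%classic : set (measurableTypeR R)) by exact: measurable_itv.
have s1 : `[0%R, K[%classic `<=` (`[0%R, +oo[%classic : set R).
  by move=> x /=; rewrite !in_itv/= => /andP[->].
have s2 : `[K, +oo[%classic `<=` (`[0%R, +oo[%classic : set R).
  by move=> x /=; rewrite !in_itv/= !andbT; apply: le_trans; exact: ltW.
suff H i j : (`|(full_kernel lam M t - trunc_kernel lam K M t) i j|%:E <=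
    c%:E * laplace lam `[K, +oo[%classic t)%E.
  apply: le_trans (frob_sq_le_entries H) _.
  by rewrite mulnn EFinM muleACA.
(* The tail may have infinite mass, which matters at [t = 0]; the right-hand side is then infinite
   too because [c] is strictly positive, the product of 0 and infinity being 0. *)
have [fin|] := boolP (laplace lam `[K, +oo[%classic t < +oo)%E; last first.
  by rewrite -leNgt leye_eq => /eqP ->; rewrite gt0_muley ?lte_fin// leey.
suff -> : (full_kernel lam M t - trunc_kernel lam K M t) i j =
    laplace_on lam `[K, +oo[%classic M t i j by exact: abs_laplace_on_entry.
rewrite /full_kernel /trunc_kernel /laplace_on !mxE.
have i1 := integrable_laplace_on m1 s1 i j (laplace_fin K t0).
have i2 := integrable_laplace_on m2 s2 i j fin.
have DE : `[0%R, +oo[%classic =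
    (`[0%R, K[%classic `|` `[K, +oo[%classic : set (measurableTypeR R)).
  apply/seteqP; split=> x /=; rewrite !in_itv/= ?andbT.
    by move=> ->; have [] := ltP x K; [left|right].
  by case=> [/andP[->//]|]; exact: le_trans (ltW K0).
rewrite DE /Rintegral integral_setU//; first last.
- apply/disj_setPS => x [] /=; rewrite !in_itv/= andbT => /andP[_ xK] Kx.
  by move: (lt_le_trans xK Kx); rewrite ltxx.
- rewrite -DE; apply: measurable_laplace_integrand => //; exact: measurable_itv.
have f1 := integrable_fin_num m1 i1; have f2 := integrable_fin_num m2 i2.
by rewrite fineD// addrAC subrr add0r.
Qed.

End MatrixKernels.

(** * Solutions of the Volterra equations *)

Section Estimates.
Context {R : realType}.
Local Notation leb := (@lebesgue_measure R).

(* Integrate [2 a f <= f^2 + a^2] and choose [a] to be the mean of [f]. *)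
Lemma sqr_Rintegral_le (t : R) (f : R -> R) : 0 <= t ->
  leb.-integrable `[0, t] (EFin \o f) ->
  (((\int[leb]_(s in `[0, t]) f s) ^+ 2)%:E <=
   t%:E * \int[leb]_(s in `[0%R, t]) (f s ^+ 2)%:E)%E.
Proof.
move=> t0 fi; set m := Rintegral _ _ _.
have lebt : leb `[0%R, t]%classic = t%:E.
  rewrite lebesgue_measure_itv/= lte_fin; case: ltP => [_|t1].
    by rewrite sube0.
  by congr EFin; apply/eqP; rewrite eq_le t0 t1.
have mt : measurable (`[0, t]%classic : set (measurableTypeR R)) by exact: measurable_itv.
have icst r : (\int[leb]_(s in `[0%R, t]) cst r s = r * t%:E)%E.
  by rewrite integral_cst//; congr (_ * _)%E; exact: lebt.
have mf : measurable_fun (`[0, t] : set R) f.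
  by apply/measurable_EFinP; exact: measurable_int fi.
have fm : (\int[leb]_(s in `[0%R, t]) (f s)%:E = m%:E)%E.
  by rewrite /m /Rintegral fineK//; exact: integrable_fin_num fi.
have X0 : (0 <= \int[leb]_(s in `[0%R, t]) (f s ^+ 2)%:E)%E.
  by apply: integral_ge0 => s _; rewrite lee_fin sqr_ge0.
have [t0'|] := boolP (0 < t); last first.
  rewrite -leNgt => tle; have {tle t0}t0 : t = 0 by apply/eqP; rewrite eq_le tle.
  suff -> : m = 0 by rewrite expr0n t0 mul0e.
  by rewrite /m /Rintegral t0 set_itv1 integral_set1.
move: X0; case X : (integral _ _ _) => [x| |]//= x0; last first.
  by rewrite gt0_muley ?lte_fin// leey.
rewrite -EFinM lee_fin; move: x0; rewrite lee_fin => x0.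
have H a : 2 * a * m <= x + a ^+ 2 * t.
  have i1 : has_integral leb `[0, t] f m by split.
  have i2 : has_integral leb `[0, t] (fun s => f s ^+ 2) x.
    split=> //; apply/integrableP; split.
      by apply/measurable_EFinP; exact: measurable_funX.
    under eq_integral do rewrite gee0_abs ?lee_fin ?sqr_ge0//.
    by rewrite X ltry.
  have i3 : has_integral leb `[0, t] (fun=> a ^+ 2) (a ^+ 2 * t).
    split.
      apply/integrableP; split; first by apply/measurable_EFinP; exact: measurable_cst.
      rewrite -[X in (X < _)%E]/(\int[leb]_(s in `[0%R, t]) cst `|(a ^+ 2)%:E| s)%E.
      by rewrite icst -EFinM ltry.
    rewrite -[LHS]/(\int[leb]_(s in `[0%R, t]) cst (a ^+ 2)%:E s)%E.
    by rewrite icst EFinM.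
  have [_ e1] := has_integralZ mt (2 * a) i1.
  have [_ e2] := has_integralD mt i2 i3.
  have [j1 _] := has_integralZ mt (2 * a) i1.
  have [j2 _] := has_integralD mt i2 i3.
  rewrite -lee_fin -e1 -e2; apply: le_integral => //.
  move=> s _; rewrite lee_fin -subr_ge0.
  rewrite (_ : _ - _ = (f s - a) ^+ 2) ?sqr_ge0//; ring.
have := H (m / t).
rewrite (_ : 2 * (m / t) * m = 2 * (m ^+ 2 / t)); last by ring.
rewrite (_ : (m / t) ^+ 2 * t = m ^+ 2 / t); last by field; rewrite gt_eqF.
move=> h; have {h} : m ^+ 2 / t <= x by lra.
by rewrite ler_pdivrMr// mulrC.
Qed.

Lemma frob_Rintegral_sq_le (d : nat) (t : R) (D : R -> 'cV[R]_d) : 0 <= t ->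
  (forall i, leb.-integrable `[0, t] (fun s => (D s i ord0)%:E)) ->
  ((frob (\col_i \int[leb]_(s in `[0, t]) D s i ord0) ^+ 2)%:E <=
   t%:E * \int[leb]_(s in `[0%R, t]) (frob (D s) ^+ 2)%:E)%E.
Proof.
move=> t0 Di; have mD i : measurable_fun (`[0, t] : set R) (fun s => D s i ord0).
  by apply/measurable_EFinP; exact: measurable_int (Di i).
have m2 i : measurable_fun (`[0, t] : set R) (fun s => (D s i ord0 ^+ 2)%:E).
  by apply/measurable_EFinP; apply: measurable_funX.
have -> : (\int[leb]_(s in `[0%R, t]) (frob (D s) ^+ 2)%:E =
    \sum_(i < d) \int[leb]_(s in `[0%R, t]) (D s i ord0 ^+ 2)%:E)%E.
  rewrite -ge0_integral_sum//; last by move=> i s _; rewrite lee_fin sqr_ge0.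
  apply: eq_integral => s _; rewrite frob_sq sumEFin; congr EFin.
  by apply: eq_bigr => i _; rewrite big_ord1.
rewrite ge0_sume_distrr; last first.
  by move=> i _; apply: integral_ge0 => s _; rewrite lee_fin sqr_ge0.
rewrite frob_sq -sumEFin; apply: lee_sum => i _; rewrite big_ord1 mxE.
by apply: sqr_Rintegral_le => //; exact: Di.
Qed.

Context {dOm : measure_display} {Om : measurableType dOm}.
Variable P : probability Om R.

(** One majorant [q] serves both parts: Cauchy-Schwarz in time gives the weight [t] of the drift,
    the isometry the weight [c] of the stochastic integral, and the three-term square the factor
    3. *)
Lemma drift_ito_estimate (d : nat) (t c : R) (y0 : 'cV[R]_d) (Y I : Om -> 'cV[R]_d)
    (D : R -> Om -> 'cV[R]_d) (q : R -> Om -> \bar R) : 0 <= t -> 0 <= c ->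
  mx_measurable setT Y -> mx_measurable setT I -> slab_nonneg t q ->
  {ae P, forall w, (forall i, leb.-integrable `[0, t] (fun s => (D s w i ord0)%:E)) /\
     Y w = y0 + \col_i \int[leb]_(s in `[0, t]) D s w i ord0 + I w} ->
  (forall s w, 0 <= s <= t -> ((frob (D s w) ^+ 2)%:E <= q s w)%E) ->
  (\int[P]_w (frob (I w) ^+ 2)%:E <= c%:E * slab_integral P t q)%E ->
  (\int[P]_w (frob (Y w) ^+ 2)%:E <=
   (3 * frob y0 ^+ 2)%:E + (3 * (t + c))%:E * slab_integral P t q)%E.
Proof.
move=> t0 c0 mY mI hq hY Dq hI.
have mY2 := mx_measurable_frob_sq mY; have mI2 := mx_measurable_frob_sq mI.
pose J w := (\int[leb]_(s in `[0%R, t]) q s w)%E.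
have mJ : measurable_fun setT J by exact: measurable_inner_leb.
have J0 w : (0 <= J w)%E.
  by apply: integral_ge0 => s; rewrite /= in_itv/=; case: hq => _; exact.
have p3 : (0 <= (3 * frob y0 ^+ 2)%:E :> \bar R)%E by rewrite lee_fin mulr_ge0 ?sqr_ge0.
have q3 : (0 <= (3 * t)%:E :> \bar R)%E by rewrite lee_fin mulr_ge0.
have r3 w : (0 <= 3%:E * (frob (I w) ^+ 2)%:E)%E by rewrite mule_ge0 ?lee_fin ?sqr_ge0.
have s3 w : (0 <= (3 * t)%:E * J w)%E by rewrite mule_ge0.
have mqJ : measurable_fun setT (fun w => (3 * t)%:E * J w)%E by exact: measurable_funeM.
have m3I : measurable_fun setT (fun w => 3%:E * (frob (I w) ^+ 2)%:E)%E.
  exact: measurable_funeM.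
apply: (@le_trans _ _ (\int[P]_w ((3 * frob y0 ^+ 2)%:E + (3 * t)%:E * J w +
    3%:E * (frob (I w) ^+ 2)%:E))%E).
  apply: ae_ge0_le_integral => //.
  - by move=> w _; rewrite lee_fin sqr_ge0.
  - by move=> w _; rewrite !adde_ge0.
  - by apply: emeasurable_funD => //; exact: emeasurable_funD.
  apply: filterS hY => w [Di ->] _.
  apply: (@le_trans _ _ ((3 * frob y0 ^+ 2)%:E + 3%:E *
     (frob (\col_i \int[leb]_(s in `[0, t]) D s w i ord0) ^+ 2)%:E +
     3%:E * (frob (I w) ^+ 2)%:E)%E).
    by rewrite -!EFinM -!EFinD lee_fin frob_sqD3.
  apply: leeD => //; apply: leeD => //; rewrite (EFinM 3 t) -muleA.
  apply: lee_wpmul2l => //; apply: le_trans (frob_Rintegral_sq_le t0 Di) _.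
  apply: lee_wpmul2l => //; apply: ge0_le_integral_nomeas => s.
    by rewrite lee_fin sqr_ge0.
  by rewrite /= in_itv/=; exact: Dq.
rewrite ge0_integralD//; last 2 first.
- by move=> w _; rewrite adde_ge0.
- exact: emeasurable_funD.
have P1 (r : \bar R) : (\int[P]_w (fun=> r) w = r)%E.
  by rewrite integral_cst// -[RHS]mule1; congr (_ * _)%E; exact: probability_setT.
rewrite ge0_integralD// P1 -addeA.
apply: leeD => //; rewrite !ge0_integralZl//; last by move=> w _; rewrite lee_fin sqr_ge0.
have S0 := slab_integral_ge0 P hq.
rewrite mulrDr (EFinD (3 * t)) [leRHS]ge0_muleDl ?lee_fin ?mulr_ge0//.
apply: leeD => //; rewrite (EFinM 3 c) -muleA; exact: lee_wpmul2l.
Qed.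

End Estimates.

Section Growth.
Context {R : realType} (d p : nat) (f : 'cV[R]_d -> 'M[R]_(d, p)) (L : R).
Hypotheses (L0 : 0 <= L) (fL : forall x y, frob (f x - f y) <= L * frob (x - y)).

Lemma lipschitz_frob_sq x y : frob (f x - f y) ^+ 2 <= L ^+ 2 * frob (x - y) ^+ 2.
Proof. by rewrite -exprMn ler_pXn2r// nnegrE ?mulr_ge0 ?frob_ge0. Qed.

Lemma growth_frob_sq x :
  frob (f x) ^+ 2 <= (2 * frob (f 0) ^+ 2 + 2 * L ^+ 2) * (1 + frob x ^+ 2).
Proof.
have := lipschitz_frob_sq x 0; rewrite subr0 => lx.
have := frob_sqD (f x - f 0) (f 0); rewrite subrK => h.
have := sqr_ge0 (frob (f 0)); have := sqr_ge0 (frob x); have := sqr_ge0 L.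
set a := frob (f 0) ^+ 2 in h *; set b := frob x ^+ 2 in lx *; set l := L ^+ 2 in lx *.
by move=> l0 b0 a0; nra.
Qed.

Lemma kernel_coeff_bound (G : 'M[R]_d) (e beta : R) (g : \bar R) (y : R) (x : 'M[R]_(d, p)) :
  ((frob G ^+ 2)%:E <= e%:E * g)%E -> frob x ^+ 2 <= beta * y ->
  (0 <= g)%E -> 0 <= e -> 0 <= beta -> 0 <= y ->
  ((frob (G *m x) ^+ 2)%:E <= (d%:R * e * beta)%:E * (g * y%:E))%E.
Proof.
move=> Gg xy g0 e0 b0 y0.
apply: (@le_trans _ _ (d%:R%:E * ((frob G ^+ 2)%:E * (frob x ^+ 2)%:E))%E).
  by rewrite -!EFinM lee_fin frob_sqM.
apply: (@le_trans _ _ (d%:R%:E * ((e%:E * g) * (beta * y)%:E))%E).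
  apply: lee_wpmul2l; first by rewrite lee_fin.
  by apply: lee_pmul => //; rewrite lee_fin sqr_ge0.
by rewrite !EFinM [in leLHS]muleACA !muleA.
Qed.

End Growth.

(** * The integral inequality fed to the Gronwall lemma *)

Section Step.
Context {R : realType} {dOm : measure_display} {Om : measurableType dOm}.
Variable P : probability Om R.
Local Notation leb := (@lebesgue_measure R).

Lemma slab_conv (t : R) (g : R -> \bar R) (v : R -> Om -> R) :
  measurable_fun setT g -> (forall u, 0 <= g u)%E ->
  slab_nonneg t (fun s w => (v s w)%:E) ->
  slab_nonneg t (fun s w => g (t - s)%R * (v s w)%:E)%E /\
  slab_integral P t (fun s w => g (t - s)%R * (v s w)%:E)%E =
  (\int[leb]_(s in `[0%R, t]) (g (t - s)%R * \int[P]_w (v s w)%:E))%E.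
Proof.
move=> mg g0 hv; have [mv v0] := hv.
have hq : slab_nonneg t (fun s w => g (t - s)%R * (v s w)%:E)%E.
  split; last by move=> s w st; rewrite mule_ge0 ?v0.
  apply: emeasurable_funM => //; apply: measurable_funTS.
  have m1 : measurable_fun setT (fun s : measurableTypeR R => g (t - s)%R).
    by apply: (measurableT_comp mg); exact: measurable_funB.
  exact: (measurableT_comp m1 measurable_fst).
split=> //; rewrite slab_integral_swap//; apply: eq_integral => s.
rewrite inE /= in_itv /= => st.
rewrite ge0_integralZl//; last by move=> w _; exact: v0.
have mp : measurable_fun setT (fun w : Om => (s, w) : measurableTypeR R * Om).
  by apply: measurable_fun_pair => //; exact: measurable_cst.
apply: (measurable_comp _ _ mv mp).
  by apply: measurableX => //; exact: measurable_itv.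
by move=> _ [w _ <-]; split => //=; rewrite in_itv.
Qed.

(** Outside [[0, t]] one of the two zero extensions vanishes, so the Volterra integral becomes a
    convolution over the whole line, the form that [volterra_gronwall] takes. *)
Lemma conv_restrict (t T : R) (g phi : R -> \bar R) : 0 <= t <= T ->
  (\int[leb]_(s in `[0%R, t]) (g (t - s)%R * phi s) =
   \int[leb]_s ((g \_ `[0%R, T]) (t - s)%R * (phi \_ `[0%R, T]) s))%E.
Proof.
move=> /andP[t0 tT]; rewrite [LHS]integral_mkcond; apply: eq_integral => s _.
rewrite !patchE !mem_setE !in_itv /=.
have [s0|s0] := leP 0 s => /=; last by rewrite mule0.
have [st|st] := leP s t => /=.
  by rewrite subr_ge0 st (le_trans st tT) lerBlDr (le_trans tT) ?lerDl.
by rewrite subr_ge0 leNgt st /= mul0e.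
Qed.

Lemma conv_mass_le (t T : R) (g : R -> \bar R) : 0 <= t <= T ->
  measurable_fun setT g -> (forall u, 0 <= g u)%E ->
  (\int[leb]_(s in `[0%R, t]) g (t - s)%R <= \int[leb]_(s in `[0%R, T]) g s)%E.
Proof.
move=> tT mg g0.
have mi : measurable (`[0%R, T]%classic : set (measurableTypeR R)) by exact: measurable_itv.
have mgT : measurable_fun setT (g \_ `[0%R, T]%classic).
  by apply/(measurable_restrictT g mi); exact: measurable_funTS.
have gT0 u : (0 <= (g \_ `[0%R, T]%classic) u)%E by rewrite patchE; case: ifP.
rewrite [leRHS]integral_mkcond -(ge0_integral_reflect t mgT gT0).
have := @conv_restrict t T g (fun=> 1%E) tT.
under eq_integral do rewrite mule1; move=> ->.
apply: ge0_le_integral_nomeas => s _; rewrite [((fun=> 1%E) \_ _) s]patchE; case: ifP => _.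
- by rewrite mule1.
- by rewrite mule0.
- by rewrite mule1.
- by rewrite mule0.
Qed.

(* In the Gronwall inequality [g1] is the kernel of the source term and [g2] that
   of the unknown. *)
Lemma volterra_step (d : nat) (t T c kap U : R) (y0 : 'cV[R]_d) (Y I : Om -> 'cV[R]_d)
    (D : R -> Om -> 'cV[R]_d) (g1 g2 : R -> \bar R) (u v : R -> Om -> R) :
  0 <= t <= T -> 0 <= c -> 0 <= kap ->
  measurable_fun setT g1 -> measurable_fun setT g2 ->
  (forall r, 0 <= g1 r)%E -> (forall r, 0 <= g2 r)%E ->
  slab_nonneg t (fun s w => (u s w)%:E) -> slab_nonneg t (fun s w => (v s w)%:E) ->
  (forall s, 0 <= s <= t -> (\int[P]_w (u s w)%:E <= U%:E)%E) ->
  let q s w := (kap%:E * (g1 (t - s)%R * (u s w)%:E) +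
                kap%:E * (g2 (t - s)%R * (v s w)%:E))%E in
  mx_measurable setT Y -> mx_measurable setT I ->
  {ae P, forall w, (forall i, leb.-integrable `[0, t] (fun s => (D s w i ord0)%:E)) /\
     Y w = y0 + \col_i \int[leb]_(s in `[0, t]) D s w i ord0 + I w} ->
  (forall s w, 0 <= s <= t -> ((frob (D s w) ^+ 2)%:E <= q s w)%E) ->
  (\int[P]_w (frob (I w) ^+ 2)%:E <= c%:E * slab_integral P t q)%E ->
  (\int[P]_w (frob (Y w) ^+ 2)%:E <=
   (3 * frob y0 ^+ 2)%:E +
   (3 * (T + c) * kap)%:E * (U%:E * \int[leb]_(s in `[0%R, T]) g1 s) +
   (3 * (T + c) * kap)%:E *
     \int[leb]_(s in `[0%R, t]) (g2 (t - s)%R * \int[P]_w (v s w)%:E))%E.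
Proof.
move=> tT c0 kap0 mg1 mg2 g10 g20 hu hv uU q mY mI hY Dq Iq.
have /andP[t0 tleT] := tT.
have [hq1 e1] := slab_conv mg1 g10 hu; have [hq2 e2] := slab_conv mg2 g20 hv.
have k0 : (0 <= kap%:E)%E by rewrite lee_fin.
have hkq1 := slab_nonnegZ k0 hq1; have hkq2 := slab_nonnegZ k0 hq2.
have hq : slab_nonneg t q by exact: slab_nonnegD.
apply: le_trans (drift_ito_estimate t0 c0 mY mI hq hY Dq Iq) _.
have qE : slab_integral P t q = (kap%:E *
    (\int[leb]_(s in `[0%R, t]) (g1 (t - s)%R * \int[P]_w (u s w)%:E)) +
    kap%:E * (\int[leb]_(s in `[0%R, t]) (g2 (t - s)%R * \int[P]_w (v s w)%:E)))%E.
  apply: etrans (slab_integralD P hkq1 hkq2) _.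
  by rewrite (slab_integralZ P k0 hq1) (slab_integralZ P k0 hq2) e1 e2.
rewrite -addeA; apply: leeD => //.
have B0 : (0 <= (3 * (T + c) * kap)%:E :> \bar R)%E.
  by rewrite lee_fin !mulr_ge0// addr_ge0// (le_trans t0).
have i1 : (0 <= \int[leb]_(s in `[0%R, t]) (g1 (t - s)%R * \int[P]_w (u s w)%:E))%E.
  apply: integral_ge0 => s; rewrite /= in_itv/= => st; apply: mule_ge0 => //.
  by apply: integral_ge0 => w _; case: hu => _; apply.
have i2 : (0 <= \int[leb]_(s in `[0%R, t]) (g2 (t - s)%R * \int[P]_w (v s w)%:E))%E.
  apply: integral_ge0 => s; rewrite /= in_itv/= => st; apply: mule_ge0 => //.
  by apply: integral_ge0 => w _; case: hv => _; apply.
rewrite qE -ge0_muleDr// muleA -EFinM.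
apply: (@le_trans _ _ ((3 * (T + c) * kap)%:E *
  ((\int[leb]_(s in `[0%R, t]) (g1 (t - s)%R * \int[P]_w (u s w)%:E)) +
   (\int[leb]_(s in `[0%R, t]) (g2 (t - s)%R * \int[P]_w (v s w)%:E))))%E).
  apply: lee_wpmul2r; first exact: adde_ge0.
  by rewrite lee_fin ler_wpM2r// ler_wpM2l// lerD2r.
rewrite ge0_muleDr//; apply: leeD => //; apply: lee_wpmul2l => //.
have U0 : (0 <= U%:E)%E.
  have t00 : 0 <= (0 : R) <= t by rewrite lexx.
  by apply: le_trans (uU 0 t00); apply: integral_ge0 => w _; case: hu => _; apply.
apply: (@le_trans _ _ (\int[leb]_(s in `[0%R, t]) (U%:E * g1 (t - s)%R))%E).
  apply: ge0_le_integral_nomeas => s; rewrite /= in_itv/= => st.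
    by apply: mule_ge0 => //; apply: integral_ge0 => w _; case: hu => _; apply.
  by rewrite muleC; apply: lee_wpmul2r => //; exact: uU.
rewrite ge0_integralZl//; last first.
  by apply: measurable_funTS; apply: (measurableT_comp mg1); exact: measurable_funB.
by apply: lee_wpmul2l => //; exact: conv_mass_le.
Qed.

End Step.

(** The order of the quantifiers is the point: [C] is fixed before the probability space, the source
    and the process, so the same [C] serves for the moments of [X] and for the difference. *)
Lemma expected_gronwall (R : realType) (g : R -> \bar R) (T B : R) :
  measurable_fun setT g -> (forall u, 0 <= g u)%E ->
  (\int[lebesgue_measure]_(u in `[0%R, T]) g u < +oo)%E -> 0 <= B ->
  exists2 C : R, 0 < C &
  forall (dOm : measure_display) (Om : measurableType dOm) (P : probability Om R)
    (A : R) (v : R -> Om -> R), 0 <= A ->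
    slab_nonneg T (fun s w => (v s w)%:E) ->
    (\int[lebesgue_measure]_(s in `[0%R, T]) \int[P]_w (v s w)%:E < +oo)%E ->
    (forall t, 0 <= t <= T -> (\int[P]_w (v t w)%:E <= A%:E + B%:E *
      \int[lebesgue_measure]_(s in `[0%R, t]) (g (t - s)%R * \int[P]_w (v s w)%:E))%E) ->
    forall t, 0 <= t <= T -> (\int[P]_w (v t w)%:E <= (C * A)%:E)%E.
Proof.
move=> mg g0 gi B0.
have mi : measurable (`[0%R, T]%classic : set (measurableTypeR R)) by exact: measurable_itv.
have mk : measurable_fun setT (g \_ `[0%R, T]%classic).
  by apply/(measurable_restrictT g mi); exact: measurable_funTS.
have k0 u : (0 <= (g \_ `[0%R, T]%classic) u)%E by rewrite patchE; case: ifP.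
have out (f : R -> \bar R) u : ~~ (0 <= u <= T) -> (f \_ `[0%R, T]%classic) u = 0%E.
  by rewrite patchE mem_setE in_itv/= => /negbTE ->.
have kneg u : u < 0 -> (g \_ `[0%R, T]%classic) u = 0%E.
  by move=> u0; apply: out; rewrite leNgt u0.
have ki : (\int[lebesgue_measure]_u (g \_ `[0%R, T]%classic) u < +oo)%E.
  by rewrite -integral_mkcond.
have [C C0 H] := volterra_gronwall T mk k0 kneg ki B0.
exists C => // dOm Om P A v A0 hv vi vA t tT.
pose f s := (\int[P]_w (v s w)%:E)%E.
have f0 s : 0 <= s <= T -> (0 <= f s)%E.
  by move=> sT; apply: integral_ge0 => w _; case: hv => _; apply.
have := H A (f \_ `[0%R, T]%classic) A0.
have inn s : 0 <= s <= T -> (f \_ `[0%R, T]%classic) s = f s.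
  by rewrite patchE mem_setE in_itv/= => ->.
move=> {}H; rewrite -/(f t) -inn//; apply: H => //.
- by apply/(measurable_restrictT f mi); exact: measurable_inner_P.
- by move=> s; rewrite patchE mem_setE in_itv/=; case: ifP => // /f0.
- by move=> s s0; apply: out; rewrite leNgt s0.
- by move=> s s0; apply: out; rewrite negb_and -!ltNge s0 orbT.
- by rewrite -integral_mkcond.
- by move=> s sT; rewrite inn// -conv_restrict//; exact: vA.
Qed.

Section Solutions.
Context {R : realType} {dOm : measure_display} {Om : measurableType dOm}.
Variables (P : probability Om R) (d : nat).
Variables (F : R -> set (set Om)) (W : R -> Om -> 'cV[R]_d).
Hypotheses (hF : filtration F) (hW : brownian_motion P F W).
Local Notation leb := (@lebesgue_measure R).

(** Comparison with the zero integral turns [ito_diff_estimate] into the bound for a single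
    integral. *)
Lemma ito_zero (t : R) : 0 <= t ->
  is_ito_integral P F W t (fun _ _ => 0) (fun=> 0).
Proof.
move=> t0; case: hF => sF Fm _.
have zwrt (s : R) (m n : nat) : 0 <= s ->
    mx_measurable_wrt (F s) (fun _ : Om => 0 : 'M[R]_(m, n)).
  move=> s0 i j; under eq_fun do rewrite mxE.
  apply/(fmeasP (fun=> 0 : R) (sF _ s0)); exact: measurable_cst.
(* The partition with the single step from 0 to [t], since a simple process must reach [t]. *)
pose tau (k : nat) : R := if k == 0%N then 0 else t.
have hs : is_simple F t 1 tau (fun _ _ => 0).
  split=> //.
  - by case.
  - by case=> // _; exact: zwrt.
  - by exists 0 => k w _; rewrite frob0.
have sp s w : simple_process 1 tau (fun _ _ => 0 : 'M[R]_d) s w = 0.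
  by rewrite /simple_process big_ord1 scaler0.
have si w : simple_integral W 1 tau (fun _ _ => 0 : 'M[R]_d) w = 0.
  by rewrite /simple_integral big_ord1 mul0mx.
split.
- move=> i j.
  rewrite (_ : (fun _ => _) = cst 0); first exact: measurable_cst.
  by apply/funext => ?; rewrite mxE.
- by move=> s s0 _; exact: zwrt.
- move=> i j.
  rewrite (_ : (fun _ => _) = cst 0); first exact: measurable_cst.
  by apply/funext => ?; rewrite mxE.
exists (fun=> 1%N), (fun=> tau), (fun _ _ _ => 0); split => //.
- rewrite (_ : (fun _ => _) = cst 0%E); first exact: cvg_cst.
  apply/funext => k; apply: integral0_eq => w _; apply: integral0_eq => s _.
  by rewrite sp subr0 frob0 expr0n.
- rewrite (_ : (fun _ => _) = cst 0%E); first exact: cvg_cst.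
  apply/funext => k; rewrite unlock; apply: integral0_eq => w _.
  by rewrite si subr0 frob0 expr0n.
Qed.

Lemma ito_estimate (t : R) (H : R -> Om -> 'M[R]_d) (I : Om -> 'cV[R]_d) : 0 <= t ->
  is_ito_integral P F W t H I ->
  (\int[P]_w (frob (I w) ^+ 2)%:E <=
   (9 * (d%:R * gvar))%:E * slab_integral P t (fun s w => (frob (H s w) ^+ 2)%:E))%E.
Proof.
move=> t0 hI; have := ito_diff_estimate hF hW hI (ito_zero t0).
under eq_integral do rewrite subr0; move=> h; apply: le_trans h _.
apply: lee_wpmul2l; first by rewrite lee_fin !mulr_ge0 ?gvar_ge0.
apply: slab_integral_le => s w _; first by rewrite lee_fin sqr_ge0.
by rewrite subr0.
Qed.

Lemma adapted_mx_measurable (m n : nat) (X : R -> Om -> 'M[R]_(m, n)) (t : R) :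
  adapted F X -> 0 <= t -> mx_measurable setT (X t).
Proof.
move=> aX t0 i j; apply: (@fmeas_measurable _ _ _ (F t)); last exact: aX.
by case: hF => _ + _; apply.
Qed.

Lemma jointly_measurable_slab (m n : nat) (X : R -> Om -> 'M[R]_(m, n)) (t : R) :
  jointly_measurable X -> mx_measurable (slab t) (fun p => X p.1 p.2).
Proof.
move=> jX i j; apply: measurable_funS (jX i j).
  by apply: measurableX => //; exact: measurable_itv.
by move=> [s w] [] /=; rewrite !in_itv/= => /andP[-> _].
Qed.

Variables (x0 : 'cV[R]_d) (b : 'cV[R]_d -> 'cV[R]_d) (sigma : 'cV[R]_d -> 'M[R]_d).
Variable (L : R).
Hypotheses (L0 : 0 <= L) (hL : lipschitz_coeffs L b sigma).

Let bL x y : frob (b x - b y) <= L * frob (x - y).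
Proof. by apply: le_trans (hL x y); rewrite lerDl frob_ge0. Qed.
Let sL x y : frob (sigma x - sigma y) <= L * frob (x - y).
Proof. by apply: le_trans (hL x y); rewrite lerDr frob_ge0. Qed.

(** A single constant for the growth and the Lipschitz bounds of both coefficients, built from the
    data that the final constant may depend on. *)
Let beta := 2 * frob (b 0) ^+ 2 + 2 * frob (sigma 0) ^+ 2 + 2 * L ^+ 2.

Let beta0 : 0 <= beta.
Proof. by rewrite /beta !addr_ge0// mulr_ge0 ?sqr_ge0. Qed.

Let b_growth x : frob (b x) ^+ 2 <= beta * (1 + frob x ^+ 2).
Proof.
apply: le_trans (growth_frob_sq L0 bL x) _; rewrite ler_wpM2r ?addr_ge0 ?sqr_ge0//.
by rewrite /beta lerD2r lerDl mulr_ge0 ?sqr_ge0.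
Qed.
Let s_growth x : frob (sigma x) ^+ 2 <= beta * (1 + frob x ^+ 2).
Proof.
apply: le_trans (growth_frob_sq L0 sL x) _; rewrite ler_wpM2r ?addr_ge0 ?sqr_ge0//.
by rewrite /beta lerD2r lerDr mulr_ge0 ?sqr_ge0.
Qed.
Let betaL : L ^+ 2 <= beta.
Proof.
have := sqr_ge0 (frob (b 0)); have := sqr_ge0 (frob (sigma 0)); have := sqr_ge0 L.
by rewrite /beta; lra.
Qed.
Let b_lip x y : frob (b x - b y) ^+ 2 <= beta * frob (x - y) ^+ 2.
Proof. by apply: le_trans (lipschitz_frob_sq L0 bL x y) _; rewrite ler_wpM2r ?sqr_ge0. Qed.
Let s_lip x y : frob (sigma x - sigma y) ^+ 2 <= beta * frob (x - y) ^+ 2.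
Proof. by apply: le_trans (lipschitz_frob_sq L0 sL x y) _; rewrite ler_wpM2r ?sqr_ge0. Qed.

Variable (e : R).
Hypothesis e0 : 0 <= e.

(** The 3 comes from the square of initial value, drift and stochastic integral; [T] from the drift
    and [9 * (d%:R * gvar)] from the Ito estimate; the 2 from the two terms of the integrand;
    [d%:R * e * beta] from kernel times coefficient. *)
Definition step_rate (T : R) := 3 * (T + 9 * (d%:R * gvar)) * (2 * (d%:R * e * beta)).

Let cI0 : 0 <= 9 * (d%:R * gvar) :> R.
Proof. by rewrite !mulr_ge0 ?gvar_ge0. Qed.
Let kap0 : 0 <= 2 * (d%:R * e * beta).
Proof. by rewrite !mulr_ge0. Qed.

(** The factor 2 is given away so that the growth bound takes the two-term shape of [diff_split],
    and the moment and difference inequalities share the same rate. *)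
Let growth_split (g : \bar R) (y : R) (X : \bar R) : (0 <= g)%E -> 0 <= y ->
  (X <= (d%:R * e * beta)%:E * (g * (1 + y)%:E))%E ->
  (X <= (2 * (d%:R * e * beta))%:E * (g * 1%:E) + (2 * (d%:R * e * beta))%:E * (g * y%:E))%E.
Proof.
move=> g0 y0 h; apply: (le_trans h).
rewrite -ge0_muleDr ?mule_ge0 ?lee_fin//.
rewrite -ge0_muleDr ?lee_fin//; apply: lee_wpmul2r.
  by rewrite mule_ge0 ?lee_fin// addr_ge0.
by rewrite lee_fin ler_peMl ?mulr_ge0// ler1n.
Qed.

Lemma solution_moment_step (T : R) (g : R -> \bar R) (G1 G2 : R -> 'M[R]_d)
    (X : R -> Om -> 'cV[R]_d) :
  measurable_fun setT g -> (forall u, 0 <= g u)%E ->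
  (forall u, 0 <= u -> ((frob (G1 u) ^+ 2)%:E <= e%:E * g u)%E) ->
  (forall u, 0 <= u -> ((frob (G2 u) ^+ 2)%:E <= e%:E * g u)%E) ->
  volterra_solution P F W x0 b sigma G1 G2 X ->
  forall t, 0 <= t <= T ->
  (\int[P]_w (frob (X t w) ^+ 2)%:E <=
   (3 * frob x0 ^+ 2)%:E + (step_rate T)%:E * (1%:E * \int[leb]_(s in `[0%R, T]) g s) +
   (step_rate T)%:E *
     \int[leb]_(s in `[0%R, t]) (g (t - s)%R * \int[P]_w (frob (X s w) ^+ 2)%:E))%E.
Proof.
move=> mg g0 hG1 hG2 [jX aX _ eqX] t tT; have /andP[t0 _] := tT.
have [I [hI hae]] := eqX t t0.
have mI : mx_measurable setT I by case: hI.
have hX := slab_nonneg_frob (jointly_measurable_slab (t := t) jX).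
have h1 : slab_nonneg t (fun (s : R) (w : Om) => (1 : R)%:E).
  by split => [|s w _]; [exact: measurable_cst|rewrite lee_fin].
(* The constant 1 in the growth bound [1 + |x|^2] acts as the source [u], with [U = 1], and both
   kernels are [g]. *)
apply: (@volterra_step _ _ _ P d t T (9 * (d%:R * gvar)) (2 * (d%:R * e * beta)) 1
  x0 (X t) I (fun s w => G1 (t - s) *m b (X s w)) g g (fun _ _ => 1)
  (fun s w => frob (X s w) ^+ 2)) => //.
- by move=> s _; rewrite integral_cst// mul1e; exact: probability_le1.
- exact: adapted_mx_measurable.
- move=> s w /andP[s0 st]; apply: growth_split => //; first exact: sqr_ge0.
  by apply: kernel_coeff_bound => //; [apply: hG1; rewrite subr_ge0|rewrite addr_ge0 ?sqr_ge0].
- apply: le_trans (ito_estimate t0 hI) _.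
  apply: lee_wpmul2l; first by rewrite lee_fin.
  apply: slab_integral_le => s w; first by rewrite lee_fin sqr_ge0.
  move=> /andP[s0 st]; apply: growth_split => //; first exact: sqr_ge0.
  by apply: kernel_coeff_bound => //; [apply: hG2; rewrite subr_ge0|rewrite addr_ge0 ?sqr_ge0].
Qed.

Let diff_split (p : nat) (G G' : 'M[R]_d) (x x' : 'M[R]_(d, p)) (g h : \bar R) (y z : R) :
  ((frob (G - G') ^+ 2)%:E <= e%:E * h)%E -> ((frob G' ^+ 2)%:E <= e%:E * g)%E ->
  frob x ^+ 2 <= beta * y -> frob (x - x') ^+ 2 <= beta * z ->
  (0 <= g)%E -> (0 <= h)%E -> 0 <= y -> 0 <= z ->
  ((frob (G *m x - G' *m x') ^+ 2)%:E <=
   (2 * (d%:R * e * beta))%:E * (h * y%:E) + (2 * (d%:R * e * beta))%:E * (g * z%:E))%E.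
Proof.
move=> Gh Gg xy xz g0 h0 y0 z0.
have -> : G *m x - G' *m x' = (G - G') *m x + G' *m (x - x').
  by rewrite mulmxBl mulmxBr addrA subrK.
apply: (@le_trans _ _ (2%:E * (frob ((G - G') *m x) ^+ 2)%:E +
    2%:E * (frob (G' *m (x - x')) ^+ 2)%:E)%E).
  by rewrite -!EFinM -EFinD lee_fin frob_sqD.
rewrite !(EFinM 2) -!muleA; apply: leeD; apply: lee_wpmul2l; rewrite ?lee_fin//.
  exact: kernel_coeff_bound.
exact: kernel_coeff_bound.
Qed.

Lemma solution_diff_step (T U : R) (g h : R -> \bar R) (G1 G2 G1' G2' : R -> 'M[R]_d)
    (X X' : R -> Om -> 'cV[R]_d) :
  measurable_fun setT g -> (forall u, 0 <= g u)%E ->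
  measurable_fun setT h -> (forall u, 0 <= h u)%E ->
  (forall u, 0 <= u -> ((frob (G1 u - G1' u) ^+ 2)%:E <= e%:E * h u)%E) ->
  (forall u, 0 <= u -> ((frob (G2 u - G2' u) ^+ 2)%:E <= e%:E * h u)%E) ->
  (forall u, 0 <= u -> ((frob (G1' u) ^+ 2)%:E <= e%:E * g u)%E) ->
  (forall u, 0 <= u -> ((frob (G2' u) ^+ 2)%:E <= e%:E * g u)%E) ->
  volterra_solution P F W x0 b sigma G1 G2 X ->
  volterra_solution P F W x0 b sigma G1' G2' X' ->
  (forall s, 0 <= s <= T -> (\int[P]_w (1 + frob (X s w) ^+ 2)%:E <= U%:E)%E) ->
  forall t, 0 <= t <= T ->
  (\int[P]_w (frob (X t w - X' t w) ^+ 2)%:E <=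
   (step_rate T)%:E * (U%:E * \int[leb]_(s in `[0%R, T]) h s) +
   (step_rate T)%:E *
     \int[leb]_(s in `[0%R, t]) (g (t - s)%R * \int[P]_w (frob (X s w - X' s w) ^+ 2)%:E))%E.
Proof.
move=> mg g0 mh h0 hG1 hG2 hG1' hG2' [jX aX _ eqX] [jX' aX' _ eqX'] hU t tT.
have /andP[t0 tleT] := tT.
have [I [hI hae]] := eqX t t0; have [I' [hI' hae']] := eqX' t t0.
have mI : mx_measurable setT I by case: hI.
have mI' : mx_measurable setT I' by case: hI'.
have mX := jointly_measurable_slab (t := t) jX.
have mX' := jointly_measurable_slab (t := t) jX'.
have hX := slab_nonneg_frob mX.
have hXX := slab_nonneg_frob (H := fun s w => X s w - X' s w) (mx_measurableB mX mX').
have h1 : slab_nonneg t (fun (s : R) (w : Om) => (1 : R)%:E).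
  by split => [|s w _]; [exact: measurable_cst|rewrite lee_fin].
have y0 s w : 0 <= 1 + frob (X s w) ^+ 2 by rewrite addr_ge0 ?sqr_ge0.
(* The initial values cancel in the difference, so [volterra_step] is used with initial value 0; its
   vanishing term is inserted to match. *)
have -> : ((step_rate T)%:E * (U%:E * \int[leb]_(s in `[0%R, T]) h s) =
    (3 * frob (0 : 'cV[R]_d) ^+ 2)%:E +
     (step_rate T)%:E * (U%:E * \int[leb]_(s in `[0%R, T]) h s))%E.
  by rewrite frob0 expr0n mulr0 add0e.
apply: (@volterra_step _ _ _ P d t T (9 * (d%:R * gvar)) (2 * (d%:R * e * beta)) U
  0 (fun w => X t w - X' t w) (fun w => I w - I' w)
  (fun s w => G1 (t - s) *m b (X s w) - G1' (t - s) *m b (X' s w)) h g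
  (fun s w => 1 + frob (X s w) ^+ 2)
  (fun s w => frob (X s w - X' s w) ^+ 2)) => //.
- exact: (slab_nonnegD h1 hX).
- by move=> s /andP[s0 st]; apply: hU; rewrite s0 (le_trans st).
- by apply: mx_measurableB; exact: adapted_mx_measurable.
- exact: mx_measurableB.
- apply: filterS2 hae hae' => w [Di Xw] [Di' Xw'].
  have mt : measurable (`[0, t]%classic : set (measurableTypeR R)) by exact: measurable_itv.
  split.
    move=> i; apply: eq_integrable (integrableB mt (Di i) (Di' i)) => // s _ /=.
    by rewrite !mxE EFinB.
  rewrite Xw Xw' add0r; apply/matrixP => i j; rewrite (ord1 j) !mxE.
  have -> : \int[leb]_(s in `[0, t])
        (G1 (t - s) *m b (X s w) - G1' (t - s) *m b (X' s w)) i ord0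
      = \int[leb]_(s in `[0, t]) (G1 (t - s) *m b (X s w)) i ord0 -
        \int[leb]_(s in `[0, t]) (G1' (t - s) *m b (X' s w)) i ord0.
    rewrite -RintegralB//.
    + by apply: eq_Rintegral => s _; rewrite !mxE.
    + exact: Di.
    + exact: Di'.
  by ring.
- move=> s w /andP[s0 st]; have u0 : 0 <= t - s by rewrite subr_ge0.
  by apply: diff_split => //; [exact: hG1|exact: hG1'|exact: sqr_ge0].
- apply: le_trans (ito_diff_estimate hF hW hI hI') _.
  apply: lee_wpmul2l; first by rewrite lee_fin.
  apply: slab_integral_le => s w; first by rewrite lee_fin sqr_ge0.
  move=> /andP[s0 st]; have u0 : 0 <= t - s by rewrite subr_ge0.
  by apply: diff_split => //; [exact: hG2|exact: hG2'|exact: sqr_ge0].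
Qed.

Lemma solution_diff_integral_lty (T : R) (G1 G2 G1' G2' : R -> 'M[R]_d)
    (X X' : R -> Om -> 'cV[R]_d) : 0 < T ->
  volterra_solution P F W x0 b sigma G1 G2 X ->
  volterra_solution P F W x0 b sigma G1' G2' X' ->
  (\int[leb]_(s in `[0%R, T]) \int[P]_w (frob (X s w - X' s w) ^+ 2)%:E < +oo)%E.
Proof.
move=> T0 [jX _ iX _] [jX' _ iX' _].
have mX := jointly_measurable_slab (t := T) jX.
have mX' := jointly_measurable_slab (t := T) jX'.
have hX := slab_nonneg_frob mX; have hX' := slab_nonneg_frob mX'.
have hXX := slab_nonneg_frob (H := fun s w => X s w - X' s w) (mx_measurableB mX mX').
have fin Y : slab_nonneg T (fun s w => (frob (Y s w) ^+ 2)%:E) ->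
    (\int[leb]_(s in `[0%R, T]) 'E_P[fun w => (frob (Y s w : 'cV[R]_d) ^+ 2)%R] < +oo)%E ->
    (slab_integral P T (fun s w => (frob (Y s w) ^+ 2)%:E) < +oo)%E.
  by move=> hY; rewrite slab_integral_swap// unlock.
have z2 : (0 <= 2%:E :> \bar R)%E by rewrite lee_fin.
have n1 := slab_nonnegZ z2 hX; have n2 := slab_nonnegZ z2 hX'.
rewrite -slab_integral_swap//.
apply: (@le_lt_trans _ _ (slab_integral P T (fun s w =>
   2%:E * (frob (X s w) ^+ 2)%:E + 2%:E * (frob (X' s w) ^+ 2)%:E)%E)).
  apply: slab_integral_le => s w _; first by rewrite lee_fin sqr_ge0.
  by rewrite -!EFinM -EFinD lee_fin frob_sqB.
rewrite (slab_integralD P n1 n2) (slab_integralZ P z2 hX) (slab_integralZ P z2 hX').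
have f1 := fin X hX (iX T T0); have f2 := fin X' hX' (iX' T T0).
have s1 := slab_integral_ge0 P hX; have s2 := slab_integral_ge0 P hX'.
have fl (x y : \bar R) : (0 <= x -> 0 <= y -> x < +oo -> y < +oo ->
    2%:E * x + 2%:E * y < +oo)%E.
  by case: x y => [x| |] [y| |]// _ _ _ _; rewrite -!EFinM -EFinD ltry.
exact (fl _ _ s1 s2 f1 f2).
Qed.

End Solutions.

(** * Choice of the constant and conclusion *)

Lemma frob_le_sup_frob (R : realType) (d : nat) (M : R -> 'M[R]_d) (rho : R) :
  bounded_measurable M -> 0 <= rho -> frob (M rho) <= sup_frob M.
Proof.
move=> [_ [c Mc]] rho0; apply: ub_le_sup.
  by exists c => _ [r /= r0 <-]; apply: Mc; move: r0; rewrite in_itv/= andbT.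
by exists rho => //=; rewrite in_itv/= andbT.
Qed.

Theorem proposition3p1 (R : realType) (d : nat) (hd : (1 <= d)%N)
    (x0 : 'cV[R]_d)
    (lam : {measure set (measurableTypeR R) -> \bar R})
    (hGbar : forall t : R, 0 < t -> (Gbar lam t < +oo)%E)
    (hGbar2 : forall S : R, 0 < S ->
       (\int[lebesgue_measure]_(t in `]0%R, S]) (Gbar lam t * Gbar lam t)
          < +oo)%E)
    (hr : forall K : R, 0 < K -> (tail_energy lam K < +oo)%E)
    (T : R) (hT : 0 < T) (L : R) (hL : 0 < L) (m1 m2 b0 s0 : R) :
  exists C : R, 0 < C /\
    forall (dOm : measure_display) (Om : measurableType dOm)
      (P : probability Om R) (F : R -> set (set Om)) (W : R -> Om -> 'cV[R]_d)
      (b : 'cV[R]_d -> 'cV[R]_d) (sigma : 'cV[R]_d -> 'M[R]_d)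
      (M1 M2 : R -> 'M[R]_d),
      filtration F -> brownian_motion P F W ->
      lipschitz_coeffs L b sigma ->
      bounded_measurable M1 -> bounded_measurable M2 ->
      sup_frob M1 = m1 -> sup_frob M2 = m2 ->
      frob (b 0) = b0 -> frob (sigma 0) = s0 ->
      forall K : R, 0 < K ->
      forall X XK : R -> Om -> 'cV[R]_d,
        volterra_solution P F W x0 b sigma
          (full_kernel lam M1) (full_kernel lam M2) X ->
        volterra_solution P F W x0 b sigma
          (trunc_kernel lam K M1) (trunc_kernel lam K M2) XK ->
        forall t : R, 0 <= t -> t <= T ->
          ('E_P[fun w => (frob (X t w - XK t w) ^+ 2)%R]
             <= C%:E * tail_energy lam K)%E.
Proof.
(* At this point [m1] and [m2] are arbitrary reals, hence the absolute values; adding 1 gives the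
   strict positivity required by the kernel bounds. The sum bounds both kernels at once. *)
pose c : R := `|m1| + `|m2| + 1.
have c0 : 0 < c by rewrite ltr_wpDl// addr_ge0.
pose e : R := (d ^ 2)%:R * (c * c).
have e0 : 0 <= e by rewrite mulr_ge0// mulr_ge0// ltW.
pose g (u : R) : \bar R := (Gbar lam u * Gbar lam u)%E.
pose h (K u : R) : \bar R :=
  (laplace lam `[K, +oo[%classic u * laplace lam `[K, +oo[%classic u)%E.
have mG : measurable_fun setT (Gbar lam).
  by apply: (measurable_laplace hGbar); [exact: measurable_itv|].
have mg : measurable_fun setT g by exact: emeasurable_funM.
have g0 u : (0 <= g u)%E by rewrite mule_ge0// laplace_ge0.
have gi : (\int[lebesgue_measure]_(u in `[0%R, T]) g u < +oo)%E.
  rewrite -integral_itv_obnd_cbnd; first exact: hGbar2.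
  exact: measurable_funTS.
(* The coefficients are not yet introduced, so the rate is written through [b0] and [s0]; [BE] below
   identifies it with [step_rate]. *)
pose beta : R := 2 * b0 ^+ 2 + 2 * s0 ^+ 2 + 2 * L ^+ 2.
pose B : R := 3 * (T + 9 * (d%:R * gvar)) * (2 * (d%:R * e * beta)).
have B0 : 0 <= B.
  rewrite /B mulr_ge0// mulr_ge0//.
  - by rewrite addr_ge0 ?(ltW hT)// !mulr_ge0 ?gvar_ge0.
  - by rewrite mulr_ge0 ?mulr_ge0// !addr_ge0// mulr_ge0 ?sqr_ge0.
have [C C0 HC] := expected_gronwall mg g0 gi B0.
pose m : R := fine (\int[lebesgue_measure]_(u in `[0%R, T]) g u)%E.
have gi0 : (0 <= \int[lebesgue_measure]_(u in `[0%R, T]) g u)%E by exact: integral_ge0.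
have mE : (\int[lebesgue_measure]_(u in `[0%R, T]) g u = m%:E)%E.
  by rewrite fineK// ge0_fin_numE.
have m0 : 0 <= m by rewrite fine_ge0.
(* The source term of the moment inequality; Gronwall turns it into the bound [C * A1] on the second
   moment of [X], and [U] adds the 1 of the growth bound. *)
pose A1 : R := 3 * frob x0 ^+ 2 + B * m.
have A10 : 0 <= A1 by rewrite addr_ge0// mulr_ge0 ?sqr_ge0.
pose U : R := 1 + C * A1.
have U0 : 0 <= U by rewrite addr_ge0// mulr_ge0// ltW.
have CBU : 0 <= C * (B * U) by apply: mulr_ge0; [exact: ltW|exact: mulr_ge0].
(* The added 1 only secures positivity, as [B] may be 0. *)
exists (C * (B * U) + 1); split; first by rewrite ltr_wpDl.
move=> dOm Om P F W b sigma M1 M2 hF hW hLip hM1 hM2 eM1 eM2 eb es K K0 X XK hX hXK t t0 tT.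
have L0 := ltW hL.
have M1c rho : 0 <= rho -> frob (M1 rho) <= c.
  move=> /(frob_le_sup_frob hM1); rewrite eM1 => /le_trans; apply.
  by rewrite /c -addrA (le_trans (ler_norm _))// lerDl addr_ge0.
have M2c rho : 0 <= rho -> frob (M2 rho) <= c.
  move=> /(frob_le_sup_frob hM2); rewrite eM2 => /le_trans; apply.
  by rewrite /c addrAC (le_trans (ler_norm _))// lerDr addr_ge0.
have [mM1 _] := hM1; have [mM2 _] := hM2.
have eE (x y : \bar R) : (x <= (d ^ 2)%:R%:E * ((c * c)%:E * y))%E -> (x <= e%:E * y)%E.
  by rewrite /e (EFinM (d ^ 2)%:R) -muleA.
have hh0 u : (0 <= h K u)%E by rewrite mule_ge0// laplace_ge0.
have mh : measurable_fun setT (h K).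
  have mK : measurable_fun setT (laplace lam `[K, +oo[%classic).
    apply: (measurable_laplace hGbar); first exact: measurable_itv.
    by move=> x /=; rewrite !in_itv/= !andbT; apply: le_trans; exact: ltW.
  exact: emeasurable_funM.
have BE : step_rate b sigma L e T = B by rewrite /step_rate /B /beta eb es.
have jX : jointly_measurable X by case: hX.
have jXK : jointly_measurable XK by case: hXK.
have sX := slab_nonneg_frob (jointly_measurable_slab (t := T) jX).
have sXX := slab_nonneg_frob (H := fun s w => X s w - XK s w)
  (mx_measurableB (jointly_measurable_slab (t := T) jX)
     (jointly_measurable_slab (t := T) jXK)).
have moment s : 0 <= s <= T -> (\int[P]_w (frob (X s w) ^+ 2)%:E <= (C * A1)%:E)%E.
  apply: (HC _ _ P A1 (fun s w => frob (X s w) ^+ 2)) => //.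
    by case: hX => _ _ /(_ T hT) + _; rewrite unlock.
  move=> r rT; have := solution_moment_step hF hW L0 hLip e0 mg g0
    (fun u u0 => eE _ _ (frob_full_kernel lam c0 mM1 M1c u))
    (fun u u0 => eE _ _ (frob_full_kernel lam c0 mM2 M2c u)) hX rT.
  by rewrite BE mE mul1e /A1 EFinD EFinM.
have momentU s : 0 <= s <= T -> (\int[P]_w (1 + frob (X s w) ^+ 2)%:E <= U%:E)%E.
  move=> sT; under eq_integral do rewrite EFinD.
  have mXs : mx_measurable setT (X s).
    by case: hX => _ aX _ _; apply: adapted_mx_measurable aX _ => //; case/andP: sT.
  rewrite ge0_integralD//; last 2 first.
  - by move=> w _; rewrite lee_fin sqr_ge0.
  - exact: mx_measurable_frob_sq.
  rewrite EFinD; apply: leeD; last exact: moment.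
  by rewrite integral_cst// mul1e; exact: probability_le1.
pose r : R := fine (tail_energy lam K).
have rE : tail_energy lam K = r%:E.
  rewrite fineK// ge0_fin_numE ?hr//.
  apply: integral_ge0 => x /=; rewrite in_itv/= andbT => Kx.
  apply: integral_ge0 => y /=; rewrite in_itv/= andbT => Ky.
  by rewrite lee_fin invr_ge0 addr_ge0// (le_trans (ltW K0)).
have r0 : 0 <= r.
  rewrite fine_ge0//; apply: integral_ge0 => x /=; rewrite in_itv/= andbT => Kx.
  apply: integral_ge0 => y /=; rewrite in_itv/= andbT => Ky.
  by rewrite lee_fin invr_ge0 addr_ge0// (le_trans (ltW K0)).
have final : (\int[P]_w (frob (X t w - XK t w) ^+ 2)%:E <= (C * (B * (U * r)))%:E)%E.
  (* The Gronwall bound is linear in the source, so [r] comes out as a factor and [K] enters nowhere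
     else. *)
  apply: (HC _ _ P (B * (U * r)) (fun s w => frob (X s w - XK s w) ^+ 2)) => //.
  - by apply: mulr_ge0 => //; exact: mulr_ge0.
  - exact: (solution_diff_integral_lty hT hX hXK).
  - move=> s sT; have := solution_diff_step hF hW L0 hLip e0 mg g0 mh hh0
      (fun u u0 => eE _ _ (frob_kernel_diff hGbar c0 mM1 M1c K0 u0))
      (fun u u0 => eE _ _ (frob_kernel_diff hGbar c0 mM2 M2c K0 u0))
      (fun u u0 => eE _ _ (frob_trunc_kernel lam c0 mM1 M1c K u))
      (fun u u0 => eE _ _ (frob_trunc_kernel lam c0 mM2 M2c K u)) hX hXK momentU sT.
    rewrite BE => H; apply: le_trans H _; apply: leeD => //.
    rewrite (EFinM B) (EFinM U); apply: lee_wpmul2l; first by rewrite lee_fin.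
    apply: lee_wpmul2l; first by rewrite lee_fin.
    by rewrite -rE; exact: integral_tail_sqr_le.
  - by rewrite t0.
rewrite unlock rE -EFinM; apply: le_trans final _; rewrite lee_fin.
have -> : (C * (B * U) + 1) * r = C * (B * (U * r)) + r by ring.
by rewrite lerDl.
Qed.
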